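(* Suppose one observes a realization of the stochastic process $Y_\epsilon(t)$, $t\in(0,1)$, defined by $dY_\epsilon(t)=S(t)\,dt+\epsilon\,dw(t)$, $\epsilon>0$, where $S\in L_2(0,1)$ is an unknown signal and $dw(t)$ is Gaussian white noise. Consider testing $H_0: S\in\Theta_0\subset L_2(0,1)$ versus $H_1: S\in\Theta_1\subset L_2(0,1)$. Closed sets and $F_\sigma$-sets are understood with respect to the weak topology of $L_2(0,1)$. (i) Let $\Theta_0$ be a bounded set in $L_2(0,1)$. Then there are consistent tests if and only if $\Theta_0$ and $\Theta_1$ are contained respectively in a closed set and an $F_\sigma$-set that are disjoint. (ii) There are pointwise consistent tests if and only if $\Theta_0$ and $\Theta_1$ are contained in disjoint $F_\sigma$-sets.
   Context: A test $K_\epsilon$ is a measurable function of the observation $Y_\epsilon$ with values in $[0,1]$ (the probability of rejecting the hypothesis). A family of tests $K_\epsilon$, $\epsilon>0$, is consistent if $\sup_{S\in\Theta_0}E_S[K_\epsilon]\to0$ as $\epsilon\to0$ and $E_S[1-K_\epsilon]\to0$ as $\epsilon\to0$ for every $S\in\Theta_1$. It is pointwise consistent if $E_S[K_\epsilon]\to0$ for every $S\in\Theta_0$ and $E_S[1-K_\epsilon]\to0$ for every $S\in\Theta_1$, as $\epsilon\to0$. An $F_\sigma$-set is a countable union of closed sets. *)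

(* Defs.v *)
From HB Require Import structures.
From mathcomp Require Import all_boot all_order all_algebra.
From mathcomp Require Import all_classical all_reals all_analysis.

Set Implicit Arguments.
Unset Strict Implicit.
Unset Printing Implicit Defensive.

Import Order.TTheory GRing.Theory Num.Theory.
Import numFieldNormedType.Exports.

Local Open Scope classical_set_scope.
Local Open Scope ring_scope.

Section SignalSpace.
Variable R : realType.

Definition lebesgue01 : set (measurableTypeR R) -> \bar R :=
  mrestr (@lebesgue_measure R) (measurable_itv `]0%R, 1%R[).

HB.instance Definition _ := Measure.on lebesgue01.

(* Elements are classes of measurable functions on the line modulo equality
   almost everywhere on (0, 1). *)
Definition L2 : Type := LspaceType2 lebesgue01.

HB.instance Definition _ := gen_eqMixin L2.
HB.instance Definition _ := gen_choiceMixin L2.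

(* A representative of the class; every use below is invariant under equality
   almost everywhere on (0, 1). *)
Definition L2_fun (S : L2) : R -> R := (S : LspaceType2 lebesgue01).

Definition L2_inner (S g : L2) : R :=
  \int[lebesgue01]_x (L2_fun S x * L2_fun g x).

Definition L2_bounded (A : set L2) : Prop :=
  exists M : R, forall S, A S ->
    ('N[lebesgue01]_2%:E[EFin \o L2_fun S] <= M%:E)%E.

(* The coarsest topology making every S |-> (S, g) continuous. *)
Definition weakL2 : Type :=
  initial_topology (L2_inner : L2 -> {ptws L2 -> R}).

HB.instance Definition _ := Topological.on weakL2.

End SignalSpace.

Section WhiteNoiseModel.
Variable R : realType.

Definition time01 : Type := {t : R | 0 < t < 1}.

Definition path_cylinders : set (set (time01 -> R)) :=
  [set C | exists (t : time01) (B : set R),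
     measurable B /\ C = [set y : time01 -> R | B (y t)]].

Definition path01 : Type := g_sigma_algebraType path_cylinders.

HB.instance Definition _ := Measurable.on path01.

Variables (d : measure_display) (Omega : measurableType d).
Variable P : probability Omega R.

(* Only the values w t with t in [0, 1] are constrained. *)
Record wiener_process (w : R -> Omega -> R) : Prop := WienerProcess {
  wiener_measurable : forall t : R, 0 <= t <= 1 -> measurable_fun setT (w t) ;
  wiener_start : {ae P, forall omega, w 0 omega = 0} ;
  (* the second parameter of normal_prob is the standard deviation *)
  wiener_gaussian : forall s t : R, 0 <= s -> s < t -> t <= 1 ->
    forall B : set R, measurable B ->
    P [set omega | B (w t omega - w s omega)] =
    normal_prob 0 (Num.sqrt (t - s)) B ;
  (* taking B i = setT for some i gives the product rule for subfamilies *)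
  wiener_independent : forall (n : nat) (t : nat -> R),
    0 <= t 0%N -> (forall i, (i < n)%N -> t i <= t i.+1) -> t n <= 1 ->
    forall B : nat -> set R, (forall i, measurable (B i)) ->
    P [set omega | forall i, (i < n)%N ->
         B i (w (t i.+1) omega - w (t i) omega)] =
    (\prod_(i < n)
       P [set omega | B i (w (t i.+1) omega - w (t i) omega)%R])%E ;
  wiener_continuous : {ae P, forall omega,
    {within `[0, 1], continuous (fun t => w t omega)}}
}.

(* dY = S dt + eps dw in integral form, Y starting from 0. *)
Definition observation (w : R -> Omega -> R) (eps : R) (S : L2 R)
    (omega : Omega) : path01 :=
  fun t : time01 =>
    \int[@lebesgue01 R]_(u in `]0, sval t]) L2_fun S u + eps * w (sval t) omega.

Definition is_test (K : path01 -> R) : Prop :=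
  measurable_fun setT K /\ forall y, 0 <= K y <= 1.

Definition err1 (w : R -> Omega -> R) (K : R -> path01 -> R) (S : L2 R)
    (eps : R) : R :=
  fine ('E_P[fun omega => K eps (observation w eps S omega)])%E.

Definition err2 (w : R -> Omega -> R) (K : R -> path01 -> R) (S : L2 R)
    (eps : R) : R :=
  fine ('E_P[fun omega => (1 - K eps (observation w eps S omega))%R])%E.

(* The supremum is taken in R, so that it is 0 when Theta0 is empty. *)
Definition consistent (w : R -> Omega -> R) (Theta0 Theta1 : set (L2 R))
    (K : R -> path01 -> R) : Prop :=
  [/\ forall eps : R, 0 < eps -> is_test (K eps),
      sup [set err1 w K S eps | S in Theta0] @[eps --> 0^'+] --> 0 &
      forall S, Theta1 S -> err2 w K S eps @[eps --> 0^'+] --> 0].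

Definition pointwise_consistent (w : R -> Omega -> R)
    (Theta0 Theta1 : set (L2 R)) (K : R -> path01 -> R) : Prop :=
  [/\ forall eps : R, 0 < eps -> is_test (K eps),
      forall S, Theta0 S -> err1 w K S eps @[eps --> 0^'+] --> 0 &
      forall S, Theta1 S -> err2 w K S eps @[eps --> 0^'+] --> 0].

End WhiteNoiseModel.

(* Main.v *)
From HB Require Import structures.
Require Import Defs.
From mathcomp Require Import all_boot all_order all_algebra.
From mathcomp Require Import all_classical all_reals all_analysis.
From mathcomp Require Import borel_hierarchy measurable_realfun ring lra.
From mathcomp Require finmap.

(** Both parts rest on two facts that relate the law of the observation to the
    weak topology on bounded sets of signals.

    From tests to sets.  For a fixed noise level, the error probability of a
    test is a weakly continuous function of the signal on every ball
    ([mean_weak_cts]).  Along a finite grid of times the observation of a signal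
    has a density with respect to pure noise, the product of the Gaussian
    likelihood ratios of the increments ([grid_likelihood]); the inner product in
    L2 of the densities of two signals is the exponential of a finite-rank
    bilinear form of the signals, hence weakly continuous, and on a ball their
    norms are bounded independently of the grid.  The continuity follows for
    events that depend on finitely many times ([law_weak_cts_cylinder]).  The
    bound on the norms makes the laws of the observations of the signals of a
    ball uniformly absolutely continuous with respect to pure noise
    ([law_dominated]), so that every event is approximated by events of this
    kind uniformly over the ball ([uniform_approximation]), and the continuity
    passes to all events, then to all tests.  Consequently, if an error tends to
    0 along the noise levels 1 / (j + 1), the signals of norm squared at most n
    whose errors stay below 1 / 3 from the index n on form a weakly closed set;
    their union over n is the F_sigma-set that is sought.  When the error of the
    first kind tends to 0 uniformly on a bounded hypothesis, one such closed set
    contains the whole hypothesis.  The sets for the two errors are disjoint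
    because the two errors add up to 1.

    From sets to tests.  Step functions with rational jumps are dense in
    L2(0, 1) ([step_dense]), so a weakly closed bounded set and a signal outside
    it are told apart by the integrals of the signals up to finitely many
    rational times ([closed_ball_separated]).  The observation at a time t is
    the integral of the signal up to t plus eps times w t, and the paths of w
    are bounded almost surely; comparing the observation with a set of signals
    at finitely many rational times, more and more of them and more and more
    precisely as eps decreases, therefore decides correctly on an event, common
    to all signals, whose probability is as close to 1 as desired.  In part (i)
    the test rejects when the observation is not close to the bounded closed set
    ([separated_consistent]).  In part (ii) the two F_sigma-sets are increasing
    unions of bounded closed sets a n and b n, and the test rejects when the
    observation gets close to the sets b n at an earlier index than to the sets
    a n ([separated_pointwise_consistent]): a signal of a n is eventually close
    to a n and far from b n, hence far from every b m with m <= n. *)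

Set Implicit Arguments.
Unset Strict Implicit.
Unset Printing Implicit Defensive.

Import Order.TTheory GRing.Theory Num.Theory.
Import numFieldNormedType.Exports.

Local Open Scope classical_set_scope.
Local Open Scope ring_scope.

(** * Measures with a density *)

Section density_measure.
Local Open Scope ereal_scope.
Context d (T : measurableType d) (R : realType).
Variable (mu : {measure set T -> \bar R}) (psi : T -> R).
Hypotheses (mpsi : measurable_fun setT psi) (psi0 : forall x, (0 <= psi x)%R).

(** The hypotheses on the density are arguments: the set function is declared as a
    measure, which it is only under them. *)
Definition mdensity & measurable_fun setT psi & (forall x, (0 <= psi x)%R) :
  set T -> \bar R := fun A => \int[mu]_(x in A) (psi x)%:E.

Local Notation md := (mdensity mpsi psi0).

Let mdensity0 : md set0 = 0.
Proof. by rewrite /mdensity integral_set0. Qed.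

Let mdensity_ge0 A : 0 <= md A.
Proof. by apply: integral_ge0 => x _; rewrite lee_fin. Qed.

Let mdensity_sigma_additive : semi_sigma_additive md.
Proof.
move=> F mF tF mUF; rewrite /mdensity ge0_integral_bigcup//; first last.
- by move=> x _; rewrite lee_fin.
- exact/measurable_EFinP/measurable_funTS.
- by apply: is_cvg_ereal_nneg_natsum_cond => n _ _; exact: mdensity_ge0.
Qed.

HB.instance Definition _ := isMeasure.Build _ _ _ md
  mdensity0 mdensity_ge0 mdensity_sigma_additive.

Import HBNNSimple.

Let integral_mdensity_nnsfun (h : {nnsfun T >-> R}) :
  \int[md]_x (h x)%:E = \int[mu]_x ((psi x)%:E * (h x)%:E).
Proof.
have mh r : measurable_fun setT (fun x => (r * \1_(h @^-1` [set r]) x)%:E).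
  by apply/measurable_EFinP/measurableT_comp.
under [LHS]eq_integral do rewrite fimfunE -fsumEFin//.
rewrite [LHS]ge0_integral_fsum//; last first.
  by move=> n x _; rewrite EFinM nnfun_muleindic_ge0.
under [RHS]eq_integral.
  move=> x xD; rewrite fimfunE -fsumEFin// ge0_mule_fsumr; last first.
    by move=> r; rewrite EFinM nnfun_muleindic_ge0.
  over.
rewrite [RHS]ge0_integral_fsum//; last 2 first.
  - by move=> r; apply: emeasurable_funM => //; exact/measurable_EFinP.
  - by move=> n x _; rewrite EFinM mule_ge0// ?nnfun_muleindic_ge0// lee_fin.
apply: eq_fsbigr => r _.
have [r0|r0] := leP 0%R r; last first.
  rewrite !integral0_eq// => x _.
    by rewrite preimage_nnfun0 ?indic0 ?mulr0 ?mule0.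
  by rewrite preimage_nnfun0 ?indic0 ?mulr0 ?mule0.
under [LHS]eq_integral do rewrite EFinM.
rewrite ge0_integralZl_EFin//; last first.
  exact/measurable_EFinP.
under [RHS]eq_integral do rewrite EFinM muleCA.
rewrite ge0_integralZl_EFin//; last 2 first.
- by move=> x _; rewrite mule_ge0 ?lee_fin.
- by apply: emeasurable_funM => //; exact/measurable_EFinP.
congr (_ * _); rewrite integral_indic// setIT.
change (\int[mu]_(x in h @^-1` [set r]) (psi x)%:E =
  \int[mu]_x ((psi x)%:E * (\1_(h @^-1` [set r]) x)%:E)).
rewrite integral_mkcond; apply: eq_integral => x _.
rewrite patchE indicE; case: ifPn => xr.
  by rewrite mule1.
by rewrite mule0.
Qed.

Lemma ge0_integral_mdensity (g : T -> \bar R) :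
  measurable_fun setT g -> (forall x, 0 <= g x) ->
  \int[md]_x g x = \int[mu]_x ((psi x)%:E * g x).
Proof.
move=> mg g0; pose g_ := nnsfun_approx measurableT mg.
have gcvg x : (g_ n x)%:E @[n --> \oo] --> g x.
  by apply: cvg_nnsfun_approx => // y _; exact: g0.
have gnd x : {homo (fun n => (g_ n x)%:E) : n m / (n <= m)%N >-> n <= m}.
  by move=> a b ab; rewrite lee_fin; exact/lefP/nd_nnsfun_approx.
transitivity (limn (fun n => \int[md]_x (g_ n x)%:E)).
  rewrite -monotone_convergence//=.
  - by apply: eq_integral => x _; exact/esym/cvg_lim.
  - by move=> n; apply/measurable_EFinP.
  - by move=> n x _; rewrite lee_fin.
transitivity (limn (fun n => \int[mu]_x ((psi x)%:E * (g_ n x)%:E))).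
  by congr (limn _); apply/funext => n; exact: integral_mdensity_nnsfun.
rewrite -monotone_convergence//=.
- by apply: eq_integral => x _; apply/cvg_lim => //; exact: cvgeZl.
- by move=> n; apply: emeasurable_funM; exact/measurable_EFinP.
- by move=> n x _; rewrite mule_ge0// lee_fin.
- by move=> x _ a b ab; rewrite lee_wpmul2l ?lee_fin//; exact: gnd.
Qed.

End density_measure.

(** * Expectation of a product of independent variables *)

Section independent_product.
Context d (Omega : measurableType d) (R : realType) (P : probability Omega R).
Variables (n : nat) (X : nat -> Omega -> R).
Hypothesis mX : forall i, (i < n)%N -> measurable_fun setT (X i).
Hypothesis indepX : forall B : nat -> set R, (forall i, measurable (B i)) ->
  P [set omega | forall i, (i < n)%N -> B i (X i omega)] =
  (\prod_(i < n) P [set omega | B i (X i omega)])%E.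

(** Independence is stated for indicators; they are replaced by the functions f i
    one index after the other.  As a function of the factor of index k alone,
    the left-hand side is an integral with respect to the law of X k under the
    measure whose density is the product of the other factors, and this law is
    proportional to that of X k. *)
Lemma integral_prod_indep (f : nat -> R -> R) (c : nat -> R) :
  (forall i, measurable_fun setT (f i)) -> (forall i x, 0 <= f i x) ->
  (forall i, (i < n)%N -> \int[P]_omega (f i (X i omega))%:E = (c i)%:E)%E ->
  (\int[P]_omega (\prod_(i < n) f i (X i omega))%:E = (\prod_(i < n) c i)%:E)%E.
Proof.
have mprod (g : nat -> R -> R) (Q : pred 'I_n) :
    (forall i, measurable_fun setT (g i)) ->
    measurable_fun setT (fun omega => \prod_(i < n | Q i) g i (X i omega)).
  move=> mg; under eq_fun do rewrite -big_filter.
  apply: measurable_prod => i _.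
  by apply: measurableT_comp => //; exact: mX.
(* The case k = n is the claim and the case k = 0 is independence. *)
suff H k (g : nat -> R -> R) (b : nat -> R) :
    (forall i, measurable_fun setT (g i)) ->
    (forall i x, 0 <= g i x) ->
    (forall i, (k <= i < n)%N -> exists2 B, measurable B & g i = \1_B) ->
    (forall i, (i < n)%N -> \int[P]_omega (g i (X i omega))%:E = (b i)%:E)%E ->
    (\int[P]_omega (\prod_(i < n) g i (X i omega))%:E = (\prod_(i < n) b i)%:E)%E.
  move=> mf f0 fc; apply: (H n) => // i /andP[/leq_ltn_trans/[apply]].
  by rewrite ltnn.
elim: k => [|k IH] in g b *; move=> mg g0 gB gb.
  have /choice[B HB] i : exists B, measurable B /\ ((i < n)%N -> g i = \1_B).
    have [ilt|nlt] := ltnP i n; last by exists set0.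
    by have [B mB ->] := gB i ilt; exists B.
  have mB i : measurable (B i) by case: (HB i).
  have bE i : (i < n)%N -> P [set omega | B i (X i omega)] = (b i)%:E.
    move=> ilt; rewrite -gb//; case: (HB i) => _ ->//.
    have mXB : measurable (X i @^-1` B i).
      by rewrite -[X in measurable X]setTI; apply: mX.
    rewrite -[RHS]/(\int[P]_omega (\1_(X i @^-1` B i) omega)%:E)%E.
    by rewrite integral_indic// setIT.
  transitivity (P [set omega | forall i, (i < n)%N -> B i (X i omega)]); last first.
    rewrite indepX// -prodEFin; apply: eq_bigr => i _; exact: bE.
  have mI : measurable [set omega | forall i, (i < n)%N -> B i (X i omega)].
    rewrite [X in measurable X](_ : _ =
        \bigcap_(i in `I_n) (X i @^-1` B i))//.
    apply: bigcap_measurableType => // i/= ilt.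
    by rewrite -[X in measurable X]setTI; apply: mX.
  rewrite -[in RHS](setIT [set omega | _]) -integral_indic//.
  apply: eq_integral => omega _; congr EFin.
  rewrite indicE; have [/set_mem/= H|/negP H] := boolP (omega \in _).
    rewrite big1// => i _; case: (HB i) => _ ->//.
    by rewrite indicE mem_set//; exact: H.
  have [i nBi] : exists i : 'I_n, ~ B i (X i omega).
    apply: contrapT => /forallNP K; apply: H; apply/mem_set => i ilt /=.
    by have /contrapT := K (Ordinal ilt).
  rewrite (bigD1 i)//=; case: (HB i) => _ ->//.
  by rewrite indicE memNset// mul0r.
have [kn|nk] := ltnP k n; last first.
  apply: IH => // i /andP[ki]; rewrite ltnNge.
  by rewrite (leq_trans nk ki).
pose ko := Ordinal kn.
pose psi omega := \prod_(i < n | i != ko) g i (X i omega).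
have mpsi : measurable_fun setT psi by exact: mprod.
have psi0 x : 0 <= psi x by apply: prodr_ge0.
have b0 i : (i < n)%N -> 0 <= b i.
  by move=> ilt; rewrite -lee_fin -gb// integral_ge0// => x _; rewrite lee_fin.
pose C := \prod_(i < n | i != ko) b i.
have C0 : 0 <= C by apply: prodr_ge0 => i _; exact: b0.
(* m B = C * P (X k \in B) by the induction hypothesis, with the indicator of B
   in place of g k. *)
pose m := mdensity P mpsi psi0.
have mXk := mX kn.
have mE B : measurable B -> pushforward m (X k) B =
    mscale (NngNum C0) (pushforward P (X k)) B.
  move=> mB; rewrite /mscale/= /pushforward/=.
  have mXB : measurable (X k @^-1` B).
    by rewrite -[X in measurable X]setTI; exact: (mX kn).
  pose g' i := if i == k then \1_B else g i.
  pose b' i := if i == k then fine (P (X k @^-1` B)) else b i.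
  have PkE : (fine (P (X k @^-1` B)))%:E = P (X k @^-1` B).
    by rewrite fineK// fin_num_measure.
  have -> : (C%:E * P (X k @^-1` B) = (\prod_(i < n) b' i)%:E)%E.
    rewrite (bigD1 ko)//= /b' eqxx mulrC EFinM PkE; congr (_%:E * _)%E.
    by apply: eq_bigr => i iko; rewrite ifF//; apply/negbTE.
  rewrite -(IH g' b'); last first.
  - move=> i ilt; rewrite /g' /b'; case: eqP => [->|_]; last exact: gb.
    rewrite PkE -[LHS]/(\int[P]_omega (\1_(X k @^-1` B) omega)%:E)%E.
    by rewrite integral_indic// setIT.
  - move=> i /andP[]; rewrite /g' leq_eqVlt eq_sym => /orP[ik _|ki ilt].
      by rewrite ik; exists B.
    by rewrite gtn_eqF//; apply: gB; rewrite ki.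
  - by move=> i x; rewrite /g'; case: ifP.
  - by move=> i; rewrite /g'; case: ifP.
  rewrite -[LHS]/(\int[P]_(x in X k @^-1` B) (psi x)%:E)%E.
  rewrite integral_mkcond; apply: eq_integral => omega _.
  rewrite patchE (bigD1 ko)//= /g' eqxx.
  rewrite [X in (_ * X)%R](_ : _ = psi omega); last first.
    by apply: eq_bigr => i iko; rewrite ifF//; apply/negbTE.
  rewrite indicE (_ : (X k omega \in B) = (omega \in X k @^-1` B)); last first.
    by apply/idP/idP => /set_mem ?; exact/mem_set.
  by case: ifPn; rewrite ?mul1r ?mul0r.
have mgk : measurable_fun setT (EFin \o g k) by exact/measurable_EFinP.
transitivity (\int[P]_omega ((psi omega)%:E * (g k (X k omega))%:E))%E.
  by apply: eq_integral => omega _; rewrite (bigD1 ko)//= mulrC EFinM.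
rewrite -(ge0_integral_mdensity P mpsi psi0); last 2 first.
- exact: (measurableT_comp mgk).
- by move=> x; rewrite lee_fin.
have e1 := ge0_integral_pushforward mXk m measurableT mgk.
have e2 := ge0_integral_pushforward mXk P measurableT mgk.
rewrite preimage_setT in e1 e2.
rewrite -[LHS]e1; last by move=> x _; rewrite lee_fin.
rewrite (eq_measure_integral (mscale (NngNum C0) (pushforward P (X k)))); last first.
  by move=> A mA _; exact: mE.
rewrite ge0_integral_mscale//; last by move=> x _; rewrite lee_fin.
rewrite [X in (_ * X)%E]e2; last by move=> x _; rewrite lee_fin.
rewrite [X in (_ * X)%E](_ : _ = (b k)%:E); last exact: gb.
by rewrite -EFinM mulrC /C [in RHS](bigD1 ko).
Qed.

End independent_product.

(** * Gaussian likelihood ratios *)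

Section lebesgue_translation.
Variable R : realType.
Notation leb := (@lebesgue_measure R).

Lemma lebesgue_measure_shift (a : R) (A : set R) : measurable A ->
  leb ((fun x => x + a) @^-1` A) = leb A.
Proof.
move=> mA; symmetry.
have ms : measurable_fun setT (fun x : measurableTypeR R => x + a : measurableTypeR R).
  exact: measurable_funD.
pose sh : {mfun measurableTypeR R >-> measurableTypeR R} :=
  HB.pack (fun x : R => x + a) (isMeasurableFun.Build _ _ _ _ _ ms).
apply: (@lebesgue_measure_unique R (pushforward leb sh)) => //.
move=> _ [[u v] _ <-].
rewrite [RHS](_ : _ = leb ((fun x => x + a) @^-1` `]u, v]))//.
rewrite (_ : _ @^-1` _ = `]u - a, v - a]%classic); last first.
  by apply/seteqP; split => x /=; rewrite !in_itv/= ltrBlDr lerBrDr.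
rewrite !lebesgue_measure_itv/= !lte_fin ltrD2r.
by case: ifP => // _; rewrite -!EFinB; congr EFin; ring.
Qed.

Lemma ge0_integral_shift (a : R) (g : R -> \bar R) :
  measurable_fun setT g -> (forall x, 0 <= g x)%E ->
  (\int[leb]_x g ((x : R) + a)%R = \int[leb]_x g x)%E.
Proof.
move=> mg g0.
have ms : measurable_fun setT (fun x : measurableTypeR R => x + a : measurableTypeR R).
  exact: measurable_funD.
have := ge0_integral_pushforward ms leb measurableT mg.
rewrite preimage_setT => <-//.
by apply: eq_measure_integral => A mA _; exact: lebesgue_measure_shift.
Qed.

End lebesgue_translation.

Section gaussian_likelihood.
Variable R : realType.
Notation leb := (@lebesgue_measure R).

(** The density of N(a, s) with respect to N(0, s). *)
Definition lik (s a x : R) : R := expR ((a * x - a ^+ 2 / 2) / s ^+ 2).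

Lemma lik_ge0 s a x : 0 <= lik s a x. Proof. exact: expR_ge0. Qed.

Lemma measurable_lik s a : measurable_fun setT (lik s a).
Proof.
apply: measurableT_comp => //; apply: measurable_funM => //.
by apply: measurable_funB => //; exact: measurable_funM.
Qed.

(** For b = 0 this identifies lik s a as a likelihood ratio; for b = a it gives
    the second moment of that ratio. *)
Lemma lik_normal_pdf s a b x : s != 0 ->
  lik s a x * normal_pdf b s x = expR (a * b / s ^+ 2) * normal_pdf (a + b) s x.
Proof.
move=> s0; rewrite !normal_pdfE// /lik /normal_fun.
rewrite mulrCA [RHS]mulrCA -!expRD; congr (_ * expR _).
by field.
Qed.

Lemma lik_lik_normal_pdf s a b x : s != 0 ->
  lik s a x * lik s b x * normal_pdf 0 s x =
  expR (a * b / s ^+ 2) * normal_pdf (a + b) s x.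
Proof.
move=> s0; rewrite -mulrA (lik_normal_pdf b)// mulr0 mul0r expR0 mul1r addr0.
exact: lik_normal_pdf.
Qed.

Lemma normal_prob_shift s a (B : set R) : s != 0 -> measurable B ->
  normal_prob 0 s [set x | B (x + a)] = normal_prob a s B.
Proof.
move=> s0 mB.
rewrite /normal_prob integral_mkcond [RHS]integral_mkcond.
rewrite -[RHS](ge0_integral_shift a)//=; last 2 first.
- apply/(measurable_restrictT _ _).1 => //.
  by apply/measurable_funTS/measurable_EFinP; exact: measurable_normal_pdf.
- move=> x; rewrite patchE; case: ifPn => // _.
  by rewrite lee_fin normal_pdf_ge0.
apply: eq_integral => x _; rewrite !patchE.
have -> : (x \in [set x0 | B (x0 + a)]) = (x + a \in B).
  by apply/idP/idP => /set_mem ?; exact/mem_set.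
case: ifP => // _; rewrite !normal_pdfE// /normal_fun.
by rewrite addrK subr0.
Qed.

Context d (Omega : measurableType d) (P : probability Omega R).
Variables (X : Omega -> R) (s : R).
Hypotheses (mX : measurable_fun setT X) (s0 : s != 0).
Hypothesis normalX : forall B, measurable B ->
  P [set omega | B (X omega)] = normal_prob 0 s B.

Lemma ge0_integral_normal (g : R -> R) :
  measurable_fun setT g -> (forall x, 0 <= g x) ->
  (\int[P]_omega (g (X omega))%:E = \int[leb]_x (g x * normal_pdf 0 s x)%:E)%E.
Proof.
move=> mg g0; have mEg : measurable_fun setT (EFin \o g) by exact/measurable_EFinP.
have mX' : measurable_fun setT (X : Omega -> measurableTypeR R) := mX.
have := ge0_integral_pushforward mX' P measurableT mEg.
rewrite preimage_setT => <-//; last by move=> x _; rewrite lee_fin.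
rewrite [LHS](eq_measure_integral (mdensity leb (measurable_normal_pdf 0 s)
  (normal_pdf_ge0 0 s))); last first.
  move=> A mA _. exact: (normalX mA).
rewrite [LHS]ge0_integral_mdensity//.
by apply: eq_integral => x _; rewrite /= -EFinM mulrC.
Qed.

(** The Cameron-Martin formula on the line. *)
Lemma integral_lik_indic a (B : set R) : measurable B ->
  (\int[P]_omega (\1_B (X omega) * lik s a (X omega))%:E =
   P [set omega | B (X omega + a)%R])%E.
Proof.
move=> mB.
rewrite (@ge0_integral_normal (fun x => \1_B x * lik s a x)); last 2 first.
- by apply: measurable_funM => //; exact: measurable_lik.
- by move=> x; rewrite mulr_ge0// lik_ge0.
have mBa : measurable [set x | B (x + a)].
  rewrite -[X in measurable X]setTI.
  have : measurable_fun setT (fun x : R => x + a) by exact: measurable_funD.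
  exact.
rewrite (normalX mBa) normal_prob_shift//.
rewrite /normal_prob [RHS]integral_mkcond; apply: eq_integral => x _.
rewrite patchE indicE -mulrA lik_normal_pdf// mulr0 mul0r expR0 mul1r addr0.
by case: ifP; rewrite ?mul1r ?mul0r.
Qed.

Lemma integral_lik_lik a b :
  (\int[P]_omega (lik s a (X omega) * lik s b (X omega))%:E =
   (expR (a * b / s ^+ 2))%:E)%E.
Proof.
rewrite (@ge0_integral_normal (fun x => lik s a x * lik s b x)); last 2 first.
- by apply: measurable_funM => //; exact: measurable_lik.
- by move=> x; rewrite mulr_ge0// lik_ge0.
under eq_integral do rewrite lik_lik_normal_pdf// EFinM.
rewrite ge0_integralZl_EFin//.
- by rewrite integral_normal_pdf mule1.
- by move=> x _; rewrite lee_fin normal_pdf_ge0.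
- by apply/measurable_EFinP; exact: measurable_normal_pdf.
Qed.

End gaussian_likelihood.

Section product_likelihood.
Context d (Omega : measurableType d) (R : realType) (P : probability Omega R).
Variables (n : nat) (X : nat -> Omega -> R) (s : nat -> R).
Hypothesis mX : forall i, (i < n)%N -> measurable_fun setT (X i).
Hypothesis s0 : forall i, (i < n)%N -> s i != 0.
Hypothesis normalX : forall i, (i < n)%N -> forall B, measurable B ->
  P [set omega | B (X i omega)] = normal_prob 0 (s i) B.
Hypothesis indepX : forall B : nat -> set R, (forall i, measurable (B i)) ->
  P [set omega | forall i, (i < n)%N -> B i (X i omega)] =
  (\prod_(i < n) P [set omega | B i (X i omega)])%E.

Definition likelihood (a : nat -> R) (omega : Omega) : R :=
  \prod_(i < n) lik (s i) (a i) (X i omega).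

Lemma likelihood_ge0 a omega : 0 <= likelihood a omega.
Proof. by apply: prodr_ge0 => i _; exact: lik_ge0. Qed.

Lemma measurable_likelihood a : measurable_fun setT (likelihood a).
Proof.
apply: measurable_prod => i _.
apply: measurableT_comp => //; [exact: measurable_lik|exact: mX].
Qed.

(** The Cameron-Martin formula in dimension n, on products of Borel sets. *)
Lemma integral_likelihood_shift a (B : nat -> set R) :
  (forall i, measurable (B i)) ->
  (\int[P]_(omega in [set omega | forall i, (i < n)%N -> B i (X i omega)])
     (likelihood a omega)%:E =
   P [set omega | forall i, (i < n)%N -> B i (X i omega + a i)%R])%E.
Proof.
move=> mB; pose f i (x : R) := \1_(B i) x * lik (s i) (a i) x.
have mBa i : measurable [set x | B i (x + a i)].
  rewrite -[X in measurable X]setTI.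
  have : measurable_fun setT (fun x : R => x + a i) by exact: measurable_funD.
  exact.
transitivity (\int[P]_omega (\prod_(i < n) f i (X i omega))%:E)%E.
  rewrite integral_mkcond; apply: eq_integral => omega _.
  rewrite patchE /f big_split/=; case: ifPn => [/set_mem/= H|H].
    rewrite [X in (X * _)%R]big1 ?mul1r// => i _.
    by rewrite indicE mem_set//; exact: H.
  have [i nBi] : exists i : 'I_n, ~ B i (X i omega).
    apply: contrapT => /forallNP K; move/negP: H; apply.
    by apply/mem_set => i ilt /=; have /contrapT := K (Ordinal ilt).
  by rewrite (bigD1 i)//= indicE memNset// !mul0r.
rewrite (@integral_prod_indep _ _ _ P n X mX indepX f
  (fun i => fine (P [set omega | B i (X i omega + a i)]))) //.
- rewrite -prodEFin (indepX mBa); apply: eq_bigr => i _.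
  rewrite fineK// fin_num_measure// -[X in measurable X]setTI.
  exact: (mX (ltn_ord i) measurableT (mBa i)).
- by move=> i; apply: measurable_funM => //; exact: measurable_lik.
- by move=> i x; rewrite mulr_ge0// lik_ge0.
- move=> i ilt; rewrite (integral_lik_indic (mX ilt) (s0 ilt))//; last exact: normalX.
  rewrite fineK// fin_num_measure// -[X in measurable X]setTI.
  exact: (mX ilt measurableT (mBa i)).
Qed.

Lemma integral_likelihoodM a b :
  (\int[P]_omega (likelihood a omega * likelihood b omega)%:E =
   (expR (\sum_(i < n) a i * b i / s i ^+ 2))%:E)%E.
Proof.
under eq_integral do rewrite -big_split/=.
rewrite (@integral_prod_indep _ _ _ P n X mX indepX
  (fun i x => lik (s i) (a i) x * lik (s i) (b i) x)
  (fun i => expR (a i * b i / s i ^+ 2))).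
- by rewrite expR_sum.
- by move=> i; apply: measurable_funM => //; exact: measurable_lik.
- by move=> i x; rewrite mulr_ge0// lik_ge0.
- move=> i ilt; apply: (integral_lik_lik (mX ilt) (s0 ilt)); exact: normalX.
Qed.

End product_likelihood.

(** * Square-integrable functions on (0, 1) *)

Section square_integrable.
Variable R : realType.
Notation leb := (@lebesgue_measure R).
Notation mu01 := (@lebesgue01 R).
Local Open Scope quotient_scope.

(** Constants and indicators are then square-integrable. *)
Lemma lebesgue01_fin : fin_num_fun mu01.
Proof.
move=> A mA; rewrite ge0_fin_numE ?measure_ge0//.
rewrite (@le_lt_trans _ _ (leb `]0%R, 1%R[%classic))//.
  rewrite /lebesgue01 /mrestr le_measure// ?inE//.
  exact: measurableI.
by rewrite lebesgue_measure_itv/= lte_fin ltr01 -EFinB ltry.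
Qed.

HB.instance Definition _ := @Measure_isFinite.Build _ _ R mu01 lebesgue01_fin.

Lemma measurable_L2_fun (S : L2 R) : measurable_fun setT (L2_fun S).
Proof.
have h := @measurable_funPT _ _ _ _
  (repr (LebesgueSpace.sort (S : LspaceType2 mu01)) :
    {mfun measurableTypeR R >-> measurableTypeR R}).
exact: h.
Qed.

Lemma L2_fun_Lfun (S : L2 R) : L2_fun S \in Lfun mu01 2%:E.
Proof.
rewrite inE; apply/andP; split; rewrite inE/=; first exact: measurable_L2_fun.
exact: (@Lebesgue_finite _ _ _ _ _ _ S).
Qed.

(** Indicators of intervals represent elements of L2, so that their inner products
    with signals are weakly continuous. *)
Lemma Lfun_L2 (f : R -> R) : f \in Lfun mu01 2%:E ->
  exists S : L2 R, {ae mu01, forall x, L2_fun S x = f x}.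
Proof.
move=> hf.
pose p1 : (1 <= (2%:E : \bar R))%E := lee1n 2.
pose Q := {mfun_ mu01, measurableTypeR R >-> measurableTypeR R}.
have mf : measurable_fun setT (f : measurableTypeR R -> measurableTypeR R).
  by move: (hf); rewrite inE => /andP[/[!inE]].
pose F' : {mfun measurableTypeR R >-> measurableTypeR R} :=
  HB.pack (f : measurableTypeR R -> measurableTypeR R)
    (isMeasurableFun.Build _ _ _ _ _ mf).
pose q : Q := \pi_Q F'.
have qF : {ae mu01, forall x, (aqEqMfun_to_fun q) x = f x}.
  have /eqP : repr q = F' %[mod Q] by rewrite reprK.
  rewrite eqmodE => /asboolP.
  by apply: filterS => x /(_ I).
have fin_q : finite_norm mu01 2%:E (aqEqMfun_to_fun q).
  move: (hf); rewrite inE => /andP[_ /[!inE]/= ff].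
  rewrite /finite_norm (_ : ('N[_]__[_])%E = 'N[mu01]_2%:E [EFin \o f])%E//.
  rewrite unlock /Lnorm; congr (_ `^ _)%E.
  apply: ge0_ae_eq_integral => //.
  - apply/measurable_EFinP.
    apply: (@measurableT_comp _ _ _ _ _ _ (fun x : R => x `^ 2)%R) => //.
    by apply: measurableT_comp => //; exact: measurable_funPT.
  - apply/measurable_EFinP.
    apply: (@measurableT_comp _ _ _ _ _ _ (fun x : R => x `^ 2)%R) => //.
    exact: measurableT_comp.
  - by move=> x _; rewrite poweR_ge0.
  - by move=> x _; rewrite poweR_ge0.
  - by apply: filterS qF => x /= -> _.
by exists (LebesgueSpace.Pack (LebesgueSpace.Class (isFinLebesgue.Build _ _ _ _ _ p1 q fin_q))).
Qed.

End square_integrable.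

Section inner_product.
Variable R : realType.
Notation leb := (@lebesgue_measure R).
Notation mu01 := (@lebesgue01 R).
Notation sqint := (Lfun mu01 2%:E).
Implicit Types f g h : R -> R.

(** The inner product is taken on functions rather than on classes, so that it
    applies to indicators and to restrictions as they stand. *)
Definition ip f g : R := \int[mu01]_x (f x * g x).

Lemma sqint_measurable f : f \in sqint -> measurable_fun setT f.
Proof. by rewrite inE => /andP[/[!inE]]. Qed.

Lemma sqintD f g : f \in sqint -> g \in sqint -> (fun x => f x + g x) \in sqint.
Proof.
move=> hf hg; have [_ H] := @Lfun_addr_closed _ _ R mu01 2%:E (lee1n 2).
exact: H.
Qed.

Lemma sqintZ a f : f \in sqint -> (fun x => a * f x) \in sqint.
Proof.
move=> hf; rewrite (_ : (fun x => _) = a \o* f); last by apply/funext => x /=; rewrite mulrC.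
by apply: Lfun_scale => //; rewrite ler1n.
Qed.

Lemma sqint_sum (I : Type) (r : seq I) (F : I -> R -> R) :
  (forall i, F i \in sqint) -> (fun x => \sum_(i <- r) F i x) \in sqint.
Proof.
move=> hF; elim: r => [|i r IH].
  under eq_fun do rewrite big_nil.
  exact: (Lfun_cst mu01 0).
under eq_fun do rewrite big_cons.
exact: sqintD.
Qed.

Lemma sqint_le f g : measurable_fun setT f -> g \in sqint ->
  (forall x, `|f x| <= `|g x|) -> f \in sqint.
Proof.
move=> mf hg fg; move: (hg); rewrite !inE => /andP[/[!inE]/= mg fing].
apply/andP; rewrite !inE; split => //=.
apply: le_lt_trans fing.
rewrite unlock /Lnorm gt0_ler_poweR//.
- by rewrite in_itv/= leey integral_ge0// => x _; rewrite poweR_ge0.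
- by rewrite in_itv/= leey integral_ge0// => x _; rewrite poweR_ge0.
apply: ge0_le_integral => //.
- by move=> x _; rewrite poweR_ge0.
- apply/measurable_EFinP.
  apply: (@measurableT_comp _ _ _ _ _ _ (fun x : R => x `^ 2)%R) => //.
  exact: measurableT_comp.
- apply/measurable_EFinP.
  apply: (@measurableT_comp _ _ _ _ _ _ (fun x : R => x `^ 2)%R) => //.
  exact: measurableT_comp.
- move=> x _; rewrite /= lee_fin ge0_ler_powR// ?nnegrE//.
Qed.

Lemma sqint_indic (A : set R) : measurable A -> \1_A \in sqint.
Proof.
move=> mA; apply: (sqint_le (g := cst 1)) => //; first exact: Lfun_cst.
by move=> x; rewrite normr1 indicE; case: (_ \in _); rewrite ?normr1 ?normr0.
Qed.

Lemma sqint_mul_indic f (A : set R) : measurable A -> f \in sqint ->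
  (fun x => f x * \1_A x) \in sqint.
Proof.
move=> mA hf; apply: (sqint_le (g := f)) => //.
  by apply: measurable_funM => //; exact: sqint_measurable.
by move=> x; rewrite indicE; case: (_ \in _); rewrite ?mulr1// mulr0 normr0.
Qed.

Lemma integrableM_sqint f g : f \in sqint -> g \in sqint ->
  mu01.-integrable setT (EFin \o (fun x => f x * g x)).
Proof. by move=> hf hg; apply/Lfun1_integrable; exact: Lfun2_mul_Lfun1. Qed.

Lemma ipC f g : ip f g = ip g f.
Proof. by apply: eq_Rintegral => x _; rewrite mulrC. Qed.

Lemma ipDl f g h : f \in sqint -> g \in sqint -> h \in sqint ->
  ip (fun x => f x + g x) h = ip f h + ip g h.
Proof.
move=> hf hg hh; rewrite /ip -RintegralD//; [|exact: integrableM_sqint..].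
by apply: eq_Rintegral => x _; rewrite mulrDl.
Qed.

Lemma ipZl a f g : f \in sqint -> g \in sqint ->
  ip (fun x => a * f x) g = a * ip f g.
Proof.
move=> hf hg; rewrite /ip -RintegralZl//; last exact: integrableM_sqint.
by apply: eq_Rintegral => x _; rewrite mulrA.
Qed.

Lemma ipDr f g h : f \in sqint -> g \in sqint -> h \in sqint ->
  ip h (fun x => f x + g x) = ip h f + ip h g.
Proof. by move=> *; rewrite ipC ipDl// ![ip h _]ipC. Qed.

Lemma ipZr a f g : f \in sqint -> g \in sqint ->
  ip g (fun x => a * f x) = a * ip g f.
Proof. by move=> *; rewrite ipC ipZl// ipC. Qed.

Lemma ip_suml (I : Type) (r : seq I) (F : I -> R -> R) g :
  (forall i, F i \in sqint) -> g \in sqint ->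
  ip (fun x => \sum_(i <- r) F i x) g = \sum_(i <- r) ip (F i) g.
Proof.
move=> hF hg; elim: r => [|i r IH].
  rewrite big_nil /ip -[RHS](mul0r (\int[mu01]_x (g x * g x))) -RintegralZl//.
    by apply: eq_Rintegral => x _; rewrite big_nil !mul0r.
  exact: integrableM_sqint.
rewrite big_cons -IH -ipDl//; last exact: sqint_sum.
by apply: eq_Rintegral => x _; rewrite big_cons.
Qed.

Lemma ip_ge0 f : 0 <= ip f f.
Proof. by apply: Rintegral_ge0 => x _; rewrite -expr2 sqr_ge0. Qed.

Lemma ip_sqD f g a : f \in sqint -> g \in sqint ->
  ip (fun x => f x + a * g x) (fun x => f x + a * g x) =
  ip f f + 2 * a * ip f g + a ^+ 2 * ip g g.
Proof.
move=> hf hg; have hag := sqintZ a hg.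
rewrite ipDl ?sqintD// !ipDr// !ipZl// !ipZr// (ipC g f).
ring.
Qed.

(** Cauchy-Schwarz without square roots; the parameter k balances the two
    terms. *)
Lemma ip_amgm (k : R) f g : 0 < k -> f \in sqint -> g \in sqint ->
  2 * `|ip f g| <= k * ip f f + k^-1 * ip g g.
Proof.
move=> k0 hf hg.
have H a : a ^+ 2 = k ^- 2 -> - (2 * (k * a) * ip f g) <= k * ip f f + k^-1 * ip g g.
  move=> ak; have := ip_ge0 (fun x => f x + a * g x).
  rewrite ip_sqD// ak -(pmulr_rge0 _ k0).
  have -> : k * (ip f f + 2 * a * ip f g + k ^- 2 * ip g g) =
    k * ip f f + k^-1 * ip g g - - (2 * (k * a) * ip f g).
    by field; rewrite gt_eqF.
  by rewrite subr_ge0.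
have [ip0|ip0] := leP 0 (ip f g).
  have := H (- k^-1); rewrite sqrrN exprVn => /(_ erefl).
  rewrite ger0_norm// => h; apply: le_trans h.
  by rewrite mulrN divff ?gt_eqF// mulrN1 mulNr opprK.
have := H (k^-1); rewrite exprVn => /(_ erefl).
rewrite ltr0_norm// => h; apply: le_trans h.
by rewrite divff ?gt_eqF// mulr1 mulrN.
Qed.

Definition prim f (t : R) : R := \int[mu01]_(u in `]0, t]) f u.

Lemma primE f t : prim f t = ip f \1_(`]0, t]%classic).
Proof.
rewrite /prim /ip Rintegral_mkcond; apply: eq_Rintegral => x _.
by rewrite patchE indicE; case: ifPn; rewrite ?mulr1 ?mulr0.
Qed.

Lemma indic_itv_split (s t : R) : 0 <= s -> s <= t -> forall x,
  \1_(`]0, t]%classic) x = \1_(`]0, s]%classic) x + \1_(`]s, t]%classic) x :> R.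
Proof.
move=> s0 st x; rewrite !indicE.
have -> : (x \in `]0, t]%classic) = (0 < x <= t).
  by apply/idP/idP => [/set_mem|?]; [|apply/mem_set]; rewrite /= in_itv/=.
have -> : (x \in `]0, s]%classic) = (0 < x <= s).
  by apply/idP/idP => [/set_mem|?]; [|apply/mem_set]; rewrite /= in_itv/=.
have -> : (x \in `]s, t]%classic) = (s < x <= t).
  by apply/idP/idP => [/set_mem|?]; [|apply/mem_set]; rewrite /= in_itv/=.
have [xs|sx] := leP x s.
  by rewrite (le_trans xs st) !andbT addr0.
by rewrite (le_lt_trans s0 sx) andbF add0r.
Qed.

Lemma ip_indic_itv f (s t : R) : f \in sqint -> 0 <= s -> s <= t ->
  ip f \1_(`]s, t]%classic) = prim f t - prim f s.
Proof.
move=> hf s0 st; rewrite !primE.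
have -> : \1_(`]0, t]%classic) =
    (fun x => \1_(`]0, s]%classic) x + \1_(`]s, t]%classic) x) :> (R -> R).
  by apply/funext => x; exact: indic_itv_split.
by rewrite ipDr ?sqint_indic// addrAC subrr add0r.
Qed.

Lemma ip_indic_indic (s t : R) : 0 <= s -> s <= t -> t < 1 ->
  ip \1_(`]s, t]%classic) \1_(`]s, t]%classic) = t - s.
Proof.
move=> s0 st t1.
transitivity (fine (\int[mu01]_x (\1_(`]s, t]%classic) x)%:E)%E).
  congr fine; apply: eq_integral => x _.
  by rewrite indicE; case: (_ \in _); rewrite ?mulr1// mulr0.
rewrite integral_indic//= setIT [X in fine X](_ : _ = leb `]s, t]%classic).
  rewrite lebesgue_measure_itv/= lte_fin.
  by case: ltgtP st => //= -> _; rewrite subrr.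
congr (leb _); rewrite setIidl// => x /=; rewrite !in_itv/= => /andP[sx xt].
by rewrite (le_lt_trans s0 sx) (le_lt_trans xt t1).
Qed.

(** The distance from f to the constants on ]s, t] is nonnegative; the constant
    below is the mean of f there. *)
Lemma prim_increment_le f (s t : R) : f \in sqint -> 0 <= s -> s < t -> t < 1 ->
  (prim f t - prim f s) ^+ 2 / (t - s) <=
  ip f (fun x => f x * \1_(`]s, t]%classic) x).
Proof.
move=> hf s0 st t1; have st0 : 0 < t - s by rewrite subr_gt0.
set I := `]s, t]%classic; have mI : measurable I by exact: measurable_itv.
rewrite -(ip_indic_itv hf s0 (ltW st)) -/I.
set c := ip f \1_I.
have hI := sqint_indic mI; have hfI := sqint_mul_indic mI hf.
have := ip_ge0 (fun x => f x * \1_I x + - (c / (t - s)) * \1_I x).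
rewrite ip_sqD//.
have idI x : \1_I x * \1_I x = \1_I x :> R.
  by rewrite indicE; case: (_ \in _); rewrite ?mulr1// mulr0.
have -> : ip (fun x => f x * \1_I x) \1_I = c.
  by apply: eq_Rintegral => x _; rewrite -mulrA idI.
have -> : ip (fun x => f x * \1_I x) (fun x => f x * \1_I x) =
    ip f (fun x => f x * \1_I x).
  by apply: eq_Rintegral => x _; rewrite -mulrA (mulrCA _ (f x)) idI.
rewrite ip_indic_indic//; last exact: ltW.
have -> : (- (c / (t - s))) ^+ 2 * (t - s) = c ^+ 2 / (t - s).
  by field; rewrite gt_eqF.
have -> : 2 * - (c / (t - s)) * c = - (2 * (c ^+ 2 / (t - s))).
  by field; rewrite gt_eqF.
lra.
Qed.

(** The left-hand side is the energy of the orthogonal projection of f on the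
    functions that are constant on the cells.  The bounds of prim_increment_le
    telescope. *)
Lemma grid_energy_le f (n : nat) (tau : nat -> R) : f \in sqint ->
  0 <= tau 0%N -> (forall i, (i < n)%N -> tau i < tau i.+1) -> tau n < 1 ->
  \sum_(i < n) (prim f (tau i.+1) - prim f (tau i)) ^+ 2 / (tau i.+1 - tau i)
  <= ip f f.
Proof.
move=> hf t0 tlt tn1.
have tau_le i : (i <= n)%N -> tau i <= tau n.
  elim: n tlt {tn1} => [|m IH] tlt; first by rewrite leqn0 => /eqP ->.
  rewrite leq_eqVlt => /predU1P[->//|im].
  by rewrite (le_trans (IH _ im))// ?ltW ?tlt// => j jm; apply: tlt; exact: ltnW.
have tau_ge i : (i <= n)%N -> 0 <= tau i.
  elim: i => // i IH ilt; rewrite (le_trans (IH (ltnW ilt)))//.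
  by rewrite ltW ?tlt.
pose E t := ip f (fun x => f x * \1_(`]0, t]%classic) x).
have hE t : (fun x => f x * \1_(`]0, t]%classic) x) \in sqint.
  exact: sqint_mul_indic.
have EB (i : 'I_n) : (prim f (tau i.+1) - prim f (tau i)) ^+ 2 /
    (tau i.+1 - tau i) <= E (tau i.+1) - E (tau i).
  have ti0 := tau_ge i (ltnW (ltn_ord i)).
  have tin : tau i.+1 < 1 by rewrite (le_lt_trans (tau_le _ (ltn_ord i))).
  rewrite (le_trans (prim_increment_le hf ti0 (tlt i (ltn_ord i)) tin))//.
  rewrite /E lerBrDr -ipDr// ?sqint_mul_indic// le_eqVlt; apply/orP; left.
  apply/eqP/eq_Rintegral => x _; congr (_ * _).
  by rewrite -mulrDr addrC -indic_itv_split// ltW// tlt.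
rewrite (le_trans (ler_sum _ (fun i _ => EB i)))//.
rewrite -(big_mkord xpredT (fun i => E (tau i.+1) - E (tau i))).
rewrite telescope_sumr//.
have : 0 <= E (tau 0%N).
  apply: Rintegral_ge0 => x _; rewrite mulrA -expr2 mulr_ge0// sqr_ge0//.
have : E (tau n) <= ip f f; last by lra.
apply: le_Rintegral => //; [exact: integrableM_sqint|exact: integrableM_sqint|].
move=> x _; rewrite mulrA ler_piMr -?expr2 ?sqr_ge0//.
Qed.

End inner_product.

(** * The weak topology *)

Section weak_topology.
Variable R : realType.
Implicit Types S g : L2 R.

Definition weak_box S0 (gs : seq (L2 R)) (e : R) : set (L2 R) :=
  [set S | forall g, g \in gs -> `|L2_inner S g - L2_inner S0 g| < e].

Lemma weak_inner_continuous g :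
  continuous ((fun S => L2_inner S g) : weakL2 R -> R).
Proof.
move=> S.
apply: (@continuous_comp _ _ _ (@L2_inner R : weakL2 R -> {ptws L2 R -> R})
  (fun f : {ptws L2 R -> R} => f g)).
  exact: initial_continuous.
exact: (@proj_continuous (L2 R) (fun=> R)).
Qed.

Lemma nbhs_weak_box S0 gs e : 0 < e -> nbhs (S0 : weakL2 R) (weak_box S0 gs e).
Proof.
move=> e0; elim: gs => [|g gs IH].
  by apply: filterS filterT => S _ g.
have /cvgrPdist_lt/(_ _ e0) H : (fun S : weakL2 R => L2_inner S g) @
  nbhs (S0 : weakL2 R) --> L2_inner S0 g by exact: weak_inner_continuous.
apply: filterS (filterI H IH) => S [h1 h2] g'; rewrite inE => /predU1P[->|].
  by rewrite distrC.
exact: h2.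
Qed.

(** The boxes form a filter base, and the filter that they generate converges
    to S0 because each inner product converges along it. *)
Lemma weak_box_base S0 (A : set (weakL2 R)) : nbhs (S0 : weakL2 R) A ->
  exists gs, exists2 e : R, 0 < e & weak_box S0 gs e `<=` A.
Proof.
pose G : set_system (L2 R) := filter_from [set p : seq (L2 R) * R | 0 < p.2]
  (fun p => weak_box S0 p.1 p.2).
have FG : Filter G.
  apply: filter_from_filter; first by exists ([::], 1) => /=.
  move=> [g1 e1] [g2 e2] /= e10 e20; exists (g1 ++ g2, Num.min e1 e2) => /=.
    by rewrite lt_min e10.
  move=> S /= H; split=> g gi.
    by have := H g; rewrite mem_cat gi lt_min => /(_ isT)/andP[].
  by have := H g; rewrite mem_cat gi orbT lt_min => /(_ isT)/andP[].
suff GS : G --> (S0 : weakL2 R).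
  by move=> /GS[[gs e] /= e0 sub]; exists gs, e.
move=> B /=; rewrite nbhsE => -[_ [[C oC <-] CS] sub].
rewrite nbhs_filterE; apply: filterS sub _.
suff FC : (@L2_inner R @ G) --> (L2_inner S0 : {ptws L2 R -> R}).
  apply: FC; exact: open_nbhs_nbhs.
apply/cvg_sup => g U.
have /= -> := @nbhsE (initial_topology (fun f : (L2 R -> R) => f g)) (L2_inner S0).
move=> [_ [[D oD <-] DS] sub'].
rewrite nbhs_filterE; apply: filterS sub' _.
have : nbhs (L2_inner S0 g) D by exact: open_nbhs_nbhs.
move=> /nbhs_ballP[e /= e0 be].
exists ([:: g], e) => //= S /(_ g); rewrite mem_seq1 eqxx => /(_ isT) h.
by apply: be; rewrite /ball/= distrC.
Qed.

(** The form in which weak closedness is proved and used. *)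
Lemma weak_closedP (A : set (weakL2 R)) :
  closed A <-> forall S0, ~ A S0 ->
  exists gs, exists2 e : R, 0 < e & forall S, weak_box S0 gs e S -> ~ A S.
Proof.
split=> [cA S0 nA|H].
  have : nbhs (S0 : weakL2 R) (~` A).
    by apply: open_nbhs_nbhs; split => //; exact: closed_openC.
  by move=> /weak_box_base[gs [e e0 sub]]; exists gs, e.
rewrite -[A]setCK; apply: open_closedC; rewrite openE => S0 /= nA.
have [gs [e e0 sub]] := H _ nA; rewrite /interior.
by apply: filterS (nbhs_weak_box S0 gs e0) => S /sub.
Qed.

(** M bounds the square of the norm. *)
Definition L2_ball (M : R) : set (L2 R) := [set S | L2_inner S S <= M].

Lemma L2_inner_ip S g : L2_inner S g = ip (L2_fun S) (L2_fun g).
Proof. by []. Qed.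

(** A ball is the intersection of half-spaces defined by inner products, hence
    weakly closed; the half-space of g = S gives back the bound on the norm
    of S. *)
Lemma L2_ballP M S :
  L2_ball M S <-> forall g, 2 * L2_inner S g <= M + L2_inner g g.
Proof.
split=> [SM g|/(_ S) /=]; last by rewrite /L2_ball/=; lra.
apply: le_trans (lerD SM (lexx _)).
have := ip_amgm ltr01 (L2_fun_Lfun S) (L2_fun_Lfun g).
rewrite invr1 !mul1r; apply: le_trans.
by rewrite ler_pM2l// ler_norm.
Qed.

Lemma L2_ball_closed M : closed (L2_ball M : set (weakL2 R)).
Proof.
rewrite (_ : L2_ball M = \bigcap_(g in [set: L2 R])
    ((fun S => L2_inner S g) @^-1` [set x | x <= (M + L2_inner g g) / 2])).
  apply: closed_bigI => g _; apply: closed_comp; last exact: closed_le.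
  by move=> S _; exact: weak_inner_continuous.
apply/seteqP; split => S.
  by move=> /L2_ballP H g _ /=; have := H g; lra.
by move=> H; apply/L2_ballP => g; have := H g I; rewrite /=; lra.
Qed.

(** Weak continuity of the restriction of f to D. *)
Definition weak_cts_on (D : set (L2 R)) (f : L2 R -> R) :=
  forall S0, D S0 -> forall eta, 0 < eta -> exists gs, exists2 e : R, 0 < e &
    forall S, D S -> weak_box S0 gs e S -> `|f S - f S0| < eta.

Lemma weak_cts_closed (D : set (L2 R)) f c : closed (D : set (weakL2 R)) ->
  weak_cts_on D f -> closed ([set S | D S /\ f S <= c] : set (weakL2 R)).
Proof.
move=> /weak_closedP cD cf; apply/weak_closedP => S0 /not_andP[nD|/negP].
  by have [gs [e e0 H]] := cD _ nD; exists gs, e => // S /H nDS [].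
rewrite -ltNge => cS0; have [DS0|nD] := pselect (D S0); last first.
  by have [gs [e e0 H]] := cD _ nD; exists gs, e => // S /H nDS [].
have := cf _ DS0 (f S0 - c); rewrite subr_gt0 => /(_ cS0)[gs [e e0 H]].
exists gs, e => // S Sb [DS fS]; have := H _ DS Sb.
by rewrite distrC ltr_norml => /andP[_]; lra.
Qed.

End weak_topology.

(** * Likelihood ratios along a finite grid of times *)

Lemma ae_eq_measure d (T : measurableType d) (R : realType)
    (mu : {measure set T -> \bar R}) (A B : set T) :
  measurable A -> measurable B -> {ae mu, forall x, A x <-> B x} -> mu A = mu B.
Proof.
move=> mA mB AB; rewrite -(setIT A) -(setIT B) -!integral_indic//.
apply: ge0_ae_eq_integral => //.
- exact/measurable_EFinP.
- exact/measurable_EFinP.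
apply: filterS AB => x AB _ /=; congr EFin; rewrite !indicE; suff -> : (x \in A) = (x \in B) by [].
by apply/idP/idP => /set_mem/AB/mem_set.
Qed.

Section path_space.
Variable R : realType.

(** The value at 0 is 0, where the observation starts. *)
Definition pathval (t : R) (y : path01 R) : R :=
  oapp (y : {t : R | 0 < t < 1} -> R) 0 (insub t).

Definition cylinders (s : seq R) : set (set (path01 R)) :=
  [set C | exists (t : time01 R) (B : set R),
     [/\ sval t \in s, measurable B & C = [set y | B (y t)]]].

Lemma cylinders_measurable s C : <<s cylinders s >> C -> measurable C.
Proof.
apply: smallest_sub; first exact: sigma_algebra_measurable.
move=> _ [t [B [_ mB ->]]]; apply: sub_sigma_algebra.
by exists t, B.
Qed.

Lemma measurable_pathval (t : R) : measurable_fun setT (pathval t).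
Proof.
rewrite /pathval; case: insubP => /= [u _ _|_]; last exact: measurable_cst.
move=> _ B mB; rewrite setTI; apply: sub_sigma_algebra.
by exists u, B.
Qed.

Lemma measurable_to_path d (T : measurableType d) (h : T -> path01 R) :
  (forall t : time01 R, measurable_fun setT (fun x => h x t)) ->
  measurable_fun setT h.
Proof.
move=> mh; apply: (@measurability _ _ T (path01 R) setT h (@path_cylinders R)) => //.
move=> _ [_ [t [B [mB ->]]] <-].
exact: (mh t measurableT B mB).
Qed.

(** The times of s in (0, 1), sorted and preceded by 0, form the grid.  The
    coordinates at these times are sums of increments, so events on the former
    are generated by events on the latter, which are independent. *)
Lemma cylinders_increments (s : seq R) : exists n (tau : nat -> R),
  [/\ tau 0%N = 0, forall i, (i < n)%N -> tau i < tau i.+1,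
     tau n < 1 &
     forall (G : set (set (path01 R))),
       (forall i B, (i < n)%N -> measurable B ->
         G [set y | B (pathval (tau i.+1) y - pathval (tau i) y)]) ->
       <<s cylinders s >> `<=` <<s G >>].
Proof.
pose l := sort <=%R (undup [seq t <- s | 0 < t < 1]).
have lE t : (t \in l) = (t \in s) && (0 < t < 1).
  by rewrite mem_sort mem_undup mem_filter andbC.
have sl : sorted <%R (0 :: l).
  rewrite lt_sorted_uniq_le /= sort_uniq undup_uniq lE ltxx andbF /=.
  rewrite path_min_sorted; first exact: (sort_sorted (@le_total _ R)).
  by apply/allP => t; rewrite lE => /andP[_ /andP[/ltW]].
exists (size l), (nth 0 (0 :: l)); split => //.
- move=> i il; have := @sorted_ltn_nth _ _ lt_trans 0 _ sl i i.+1.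
  by apply; rewrite ?inE/= ?ltnS // ltnW.
- rewrite -[size l]/((size (0 :: l)).-1) nth_last /=.
  have : last 0 l \in 0 :: l by exact: mem_last.
  by rewrite inE => /predU1P[->//|]; rewrite lE => /andP[_ /andP[]].
move=> G HG; apply: smallest_sub; first exact: smallest_sigma_algebra.
move=> _ [t [B [ts mB ->]]].
have tl : sval t \in l by rewrite lE ts; exact: (svalP t).
pose k := index (sval t) (0 :: l).
have kl : (k <= size l)%N.
  by rewrite -ltnS -[(size l).+1]/(size (0 :: l)) index_mem inE tl orbT.
have ktau : nth 0 (0 :: l) k = sval t by rewrite nth_index// inE tl orbT.
pose inc i (y : path01 R) :=
  pathval (nth 0 (0 :: l) i.+1) y - pathval (nth 0 (0 :: l) i) y.
have -> : [set y : path01 R | B (y t)] =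
    (fun y : path01 R => \sum_(i < k) inc i y) @^-1` B.
  apply/funext => y; rewrite /= -(big_mkord xpredT (inc^~ y)) telescope_sumr//.
  rewrite ktau /pathval insubT; first exact: (svalP t).
  move=> h; rewrite /= insubF ?ltxx// subr0.
  by congr (B (y _)); apply: val_inj.
have : measurable_fun setT (fun y : g_sigma_algebraType G => \sum_(i < k) inc i y).
  apply: measurable_sum => i _ B' mB'; rewrite setTI; apply: sub_sigma_algebra.
  by apply: HG => //; exact: leq_trans (ltn_ord i) kl.
by move=> /(_ measurableT _ mB); rewrite setTI.
Qed.

End path_space.

Section wiener_grid.
Context d (Omega : measurableType d) (R : realType) (P : probability Omega R).
Variables (w : R -> Omega -> R) (hw : wiener_process P w) (eps : R).
Hypothesis eps0 : 0 < eps.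
Notation mu01 := (@lebesgue01 R).
Notation sqint := (Lfun mu01 2%:E).

Definition signal_path (f : R -> R) (omega : Omega) : path01 R :=
  fun t => prim f (sval t) + eps * w (sval t) omega.

Lemma measurable_signal_path f : measurable_fun setT (signal_path f).
Proof.
apply: measurable_to_path => t; apply: measurable_funD => //.
apply: measurable_funM => //; apply: (wiener_measurable hw).
by case: t => t /= /andP[/ltW -> /ltW ->].
Qed.

(** w 0 vanishes only almost surely, while the increment of the observation over
    the first cell of a grid starts from exactly 0. *)
Definition wiener0 (t : R) omega : R := if t == 0 then 0 else w t omega.

Lemma wiener0_ae : {ae P, forall omega, forall t, wiener0 t omega = w t omega}.
Proof.
apply: filterS (wiener_start hw) => omega w00 t; rewrite /wiener0.
by case: eqP => // ->.
Qed.

Lemma measurable_wiener0 t : 0 <= t <= 1 -> measurable_fun setT (wiener0 t).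
Proof.
move=> t01; rewrite /wiener0; case: eqP => _ //.
exact: (wiener_measurable hw).
Qed.

Lemma prim0 (f : R -> R) : prim f 0 = 0.
Proof. by rewrite /prim set_itv_ge ?bnd_simp ?ltxx// Rintegral_set0. Qed.

Lemma pathval_signal_path f t omega : 0 <= t -> t < 1 ->
  pathval t (signal_path f omega) = prim f t + eps * wiener0 t omega.
Proof.
move=> t0 t1; rewrite /pathval /wiener0; case: insubP => /= [u|].
  by move=> /andP[t0' _] ut; rewrite /signal_path -/(val u) ut gt_eqF.
rewrite t1 andbT -leNgt => t0'.
have -> : t = 0 by apply/eqP; rewrite eq_le t0' t0.
by rewrite eqxx prim0 mulr0 addr0.
Qed.

End wiener_grid.

Section grid_likelihood.
Context d (Omega : measurableType d) (R : realType) (P : probability Omega R).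
Variables (w : R -> Omega -> R) (hw : wiener_process P w) (eps : R).
Hypothesis eps0 : 0 < eps.
Notation mu01 := (@lebesgue01 R).
Notation sqint := (Lfun mu01 2%:E).

(** Lam f is the density of the observation of f with respect to pure noise on
    the events that depend on the times of s.  The bilinear form in the exponent
    is the inner product, divided by eps ^+ 2, of the projections of the signals
    on the functions that are constant on the cells of the grid; the bound of
    the last clause is therefore the same for all s.  The second clause holds for
    products of events on the increments by the Cameron-Martin formula, and such
    products are stable under intersection. *)
Lemma grid_likelihood (s : seq R) : exists (Lam : (R -> R) -> Omega -> R)
    (n : nat) (k : nat -> R) (h : nat -> R -> R),
  [/\ forall f, measurable_fun setT (Lam f) /\ (forall omega, 0 <= Lam f omega),
      forall f C, f \in sqint -> <<s cylinders s >> C ->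
        P (signal_path w eps f @^-1` C) =
        (\int[P]_(omega in signal_path w eps (cst 0%R) @^-1` C) (Lam f omega)%:E)%E,
      forall f g, f \in sqint -> g \in sqint ->
        (\int[P]_omega (Lam f omega * Lam g omega)%:E =
         (expR (\sum_(i < n) k i * (ip f (h i) * ip g (h i))))%:E)%E,
      forall i, h i \in sqint &
      forall f, f \in sqint ->
        \sum_(i < n) k i * (ip f (h i) * ip f (h i)) <= ip f f / eps ^+ 2].
Proof.
have [n [tau [tau0 taulen taun gen]]] := cylinders_increments s.
have tau_le i : (i <= n)%N -> tau i <= tau n.
  elim: n taulen {taun gen} => [|m IH] tlt; first by rewrite leqn0 => /eqP ->.
  rewrite leq_eqVlt => /predU1P[->//|im].
  by rewrite (le_trans (IH _ im))// ?ltW ?tlt// => j jm; apply: tlt; exact: ltnW.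
have tau_ge i : (i <= n)%N -> 0 <= tau i.
  elim: i => [|i IH ilt]; first by rewrite tau0.
  by rewrite (le_trans (IH (ltnW ilt)))// ltW ?taulen.
have tau_lt1 i : (i <= n)%N -> tau i < 1 by move=> /tau_le/le_lt_trans; exact.
have tau01 i : (i <= n)%N -> 0 <= tau i <= 1.
  by move=> ilt; rewrite tau_ge//= ltW// tau_lt1.
pose X i omega := wiener0 w (tau i.+1) omega - wiener0 w (tau i) omega.
pose sg i := Num.sqrt (tau i.+1 - tau i).
have sg0 i : (i < n)%N -> sg i != 0.
  by move=> ilt; rewrite gt_eqF// sqrtr_gt0 subr_gt0 taulen.
have mX i : (i < n)%N -> measurable_fun setT (X i).
  move=> ilt; apply: measurable_funB; apply: (measurable_wiener0 hw).
    exact: tau01.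
  by apply: tau01; exact: ltnW.
have mW i : (i < n)%N -> measurable_fun setT
    (fun omega => w (tau i.+1) omega - w (tau i) omega).
  move=> ilt; apply: measurable_funB; apply: (wiener_measurable hw).
    exact: tau01.
  by apply: tau01; exact: ltnW.
have PX i B : (i < n)%N -> measurable B -> P [set omega | B (X i omega)] =
    P [set omega | B (w (tau i.+1) omega - w (tau i) omega)].
  move=> ilt mB; apply: ae_eq_measure.
  - by rewrite -[X in measurable X]setTI; exact: (mX i ilt measurableT _ mB).
  - by rewrite -[X in measurable X]setTI; exact: (mW i ilt measurableT _ mB).
  - by apply: filterS (wiener0_ae hw) => omega H /=; rewrite /X !H.
have normalX i : (i < n)%N -> forall B, measurable B ->
    P [set omega | B (X i omega)] = normal_prob 0 (sg i) B.
  move=> ilt B mB; rewrite PX//.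
  apply: (wiener_gaussian hw) => //; last exact/ltW/tau_lt1.
    exact/tau_ge/ltnW.
  exact: taulen.
have mcap (Y : nat -> Omega -> R) (B : nat -> set R) :
    (forall i, (i < n)%N -> measurable_fun setT (Y i)) ->
    (forall i, measurable (B i)) ->
    measurable [set omega | forall i, (i < n)%N -> B i (Y i omega)].
  move=> mY mB; rewrite [X in measurable X](_ : _ =
      \bigcap_(i in `I_n) (Y i @^-1` B i))//.
  apply: bigcap_measurableType => i/= ilt.
  by rewrite -[X in measurable X]setTI; exact: (mY i ilt measurableT _ (mB i)).
have indepX (B : nat -> set R) : (forall i, measurable (B i)) ->
    P [set omega | forall i, (i < n)%N -> B i (X i omega)] =
    (\prod_(i < n) P [set omega | B i (X i omega)])%E.
  move=> mB.
  transitivity (P [set omega | forall i, (i < n)%N ->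
      B i (w (tau i.+1) omega - w (tau i) omega)]).
    apply: ae_eq_measure; [exact: mcap|exact: mcap|].
    apply: filterS (wiener0_ae hw) => omega H /=.
    by split=> HB i ilt; have := HB i ilt; rewrite /X !H.
  rewrite (wiener_independent hw) ?tau0//; last first.
  - exact: ltW.
  - by move=> i ilt; apply/ltW/taulen.
  by apply: eq_bigr => i _; rewrite PX.
pose a (f : R -> R) i := (prim f (tau i.+1) - prim f (tau i)) / eps.
pose Lam f := likelihood n X sg (a f).
have mLam f : measurable_fun setT (Lam f) by exact: measurable_likelihood.
have Lam0 f omega : 0 <= Lam f omega by exact: likelihood_ge0.
exists Lam, n, (fun i => (eps ^+ 2 * (tau i.+1 - tau i))^-1).
exists (fun i => \1_(`]tau i, tau i.+1]%classic)).
have hs i : (\1_(`]tau i, tau i.+1]%classic) : R -> R) \in sqint.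
  by apply: sqint_indic; exact: measurable_itv.
have kE f g i : f \in sqint -> g \in sqint -> (i < n)%N ->
    (eps ^+ 2 * (tau i.+1 - tau i))^-1 *
      (ip f \1_(`]tau i, tau i.+1]%classic) * ip g \1_(`]tau i, tau i.+1]%classic)) =
    a f i * a g i / sg i ^+ 2.
  move=> hf hg ilt; rewrite !ip_indic_itv//; first last.
  - exact/ltW/taulen.
  - exact/tau_ge/ltnW.
  - exact/ltW/taulen.
  - exact/tau_ge/ltnW.
  have tp : 0 < tau i.+1 - tau i by rewrite subr_gt0 taulen.
  rewrite /sg sqr_sqrtr; last exact: ltW.
  by rewrite /a; field; rewrite !gt_eqF.
split.
- by move=> f; split.
- move=> f C hf HC.
  pose G : set (set (path01 R)) := [set C | exists B : nat -> set R,
    (forall i, measurable (B i)) /\ C = [set y | forall i, (i < n)%N ->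
      B i (pathval (tau i.+1) y - pathval (tau i) y)]].
  have GC : <<s G >> C.
    apply: (gen G) HC => i B ilt mB.
    exists (fun j => if j == i then B else setT); split.
      by move=> j; case: ifP.
    apply/seteqP; split => y /=.
      by move=> By j jn; case: eqP => // ->.
    by move=> /(_ i ilt); rewrite eqxx.
  have mf := measurable_signal_path hw eps f.
  have m0 := measurable_signal_path hw eps (cst 0).
  pose fp : {mfun Omega >-> path01 R} := HB.pack (signal_path w eps f)
    (isMeasurableFun.Build _ _ _ _ _ mf).
  pose zp : {mfun Omega >-> path01 R} := HB.pack (signal_path w eps (cst 0))
    (isMeasurableFun.Build _ _ _ _ _ m0).
  have prim00 t : prim (cst (0 : R)) t = 0.
    by rewrite /prim Rintegral_cst// mul0r.
  have incE g i omega : (i < n)%N ->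
      pathval (tau i.+1) (signal_path w eps g omega) -
      pathval (tau i) (signal_path w eps g omega) =
      eps * (X i omega + a g i).
    move=> ilt; rewrite !pathval_signal_path//; first last.
    - exact: tau_lt1.
    - exact: tau_ge.
    - exact/tau_lt1/ltnW.
    - exact/tau_ge/ltnW.
    by rewrite /X /a; field; rewrite gt_eqF.
  apply: (@g_sigma_algebra_measure_unique _ R (path01 R) G _ (fun=> setT) _ _
    (pushforward P fp) (pushforward (mdensity P (mLam f) (Lam0 f)) zp)) => //.
  + move=> _ [B [mB ->]].
    rewrite [X in measurable X](_ : _ = \bigcap_(i in `I_n)
      ((fun y => pathval (tau i.+1) y - pathval (tau i) y) @^-1` B i))//.
    apply: bigcap_measurableType => i/= ilt.
    have mi : measurable_fun setT
        (fun y : path01 R => pathval (tau i.+1) y - pathval (tau i) y).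
      by apply: measurable_funB; exact: measurable_pathval.
    by rewrite -[X in measurable X]setTI; exact: (mi measurableT _ (mB i)).
  + move=> _; exists (fun=> setT); split => //.
    by apply/seteqP; split.
  + by rewrite bigcup_const//; exists 0%N.
  + move=> _ _ [B1 [mB1 ->]] [B2 [mB2 ->]].
    exists (fun i => B1 i `&` B2 i); split; first by move=> i; exact: measurableI.
    apply/seteqP; split => y /=.
      by move=> [H1 H2] i ilt; split; [exact: H1|exact: H2].
    by move=> H; split => i ilt; have [] := H i ilt.
  + move=> _ [B [mB ->]].
    have mBe i : measurable [set x | B i (eps * x)].
      rewrite -[X in measurable X]setTI.
      have : measurable_fun setT (fun x : R => eps * x) by exact: measurable_funM.
      by move=> /(_ measurableT _ (mB i)).
    transitivity (P [set omega | forall i, (i < n)%N ->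
        [set x | B i (eps * x)] (X i omega + a f i)]).
      congr (P _); apply/seteqP; split => omega /= H i ilt.
        by have := H i ilt; rewrite incE.
      by have := H i ilt; rewrite incE.
    rewrite -(integral_likelihood_shift mX sg0 normalX indepX (a f) mBe).
    congr (integral _ _ _); apply/seteqP; split => omega /= H i ilt.
      by have := H i ilt; rewrite incE// /a !prim00 subrr mul0r addr0.
    by have := H i ilt; rewrite incE// /a !prim00 subrr mul0r addr0.
  + move=> _; rewrite [X in (X < _)%E](_ : _ = P setT)// probability_setT.
    exact: ltry.
- move=> f g hf hg; rewrite (integral_likelihoodM mX sg0 normalX indepX).
  by congr (expR _)%:E; apply: eq_bigr => i _; rewrite kE.
- by [].
- move=> f hf; have := grid_energy_le hf.
  move=> /(_ n tau); rewrite tau0 => /(_ (lexx _) taulen taun) H.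
  rewrite ler_pdivlMr ?exprn_gt0// mulrC; apply: le_trans H.
  rewrite mulr_sumr; apply: ler_sum => i _.
  have tp : 0 < tau i.+1 - tau i by rewrite subr_gt0 taulen.
  rewrite le_eqVlt; apply/orP; left; apply/eqP.
  rewrite !ip_indic_itv//; first last.
  + exact/ltW/taulen.
  + exact/tau_ge/ltnW.
  by field; rewrite !gt_eqF.
Qed.

End grid_likelihood.

(** * Uniform approximation of events in a dominated family *)

Section uniform_approximation.
Context d (T : measurableType d) (R : realType) (J : Type).
Variables (m : J -> probability T R) (i0 : J) (alg : set (set T)) (c : R).
Hypothesis alg_measurable : alg `<=` measurable.
Hypothesis algC : forall A, alg A -> alg (~` A).
Hypothesis algU : forall A B, alg A -> alg B -> alg (A `|` B).
Hypothesis algT : alg setT.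
Hypothesis gen : measurable `<=` <<s alg >>.
Hypothesis c0 : 0 < c.
Hypothesis dominated : forall i A lam, alg A -> 0 < lam ->
  fine (m i A) <= lam * fine (m i0 A) + c / lam.

Definition symdiff (A B : set T) := (A `\` B) `|` (B `\` A).

Let mr i A := fine (m i A).

Let mrE i A : measurable A -> (mr i A)%:E = m i A.
Proof. by move=> mA; rewrite fineK// fin_num_measure. Qed.

Let mr_le i A B : measurable A -> measurable B -> A `<=` B -> mr i A <= mr i B.
Proof. by move=> mA mB AB; rewrite -lee_fin !mrE// le_measure// inE. Qed.

Let mrU i A B : measurable A -> measurable B -> mr i (A `|` B) <= mr i A + mr i B.
Proof.
move=> mA mB; rewrite -lee_fin EFinD !mrE// ?measureU2//.
exact: measurableU.
Qed.

Lemma measurable_symdiff A B : measurable A -> measurable B ->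
  measurable (symdiff A B).
Proof. by move=> mA mB; apply: measurableU; exact: measurableD. Qed.

Let approximable A := measurable A /\ forall eta, 0 < eta ->
  exists2 B, alg B & forall i, mr i (symdiff A B) <= eta.

Let approx_dominated A i lam : approximable A -> 0 < lam ->
  mr i A <= lam * mr i0 A + c / lam.
Proof.
move=> [mA apA] lam0; apply/ler_addgt0Pr => e e0.
have l1 : 0 < lam + 1 by rewrite addr_gt0.
have [B aB AB] := apA (e / (lam + 1)) (divr_gt0 e0 l1).
have mB := alg_measurable aB; have mS := measurable_symdiff mA mB.
have h1 : mr i A <= mr i B + mr i (symdiff A B).
  apply: le_trans (mrU i mB mS); apply: mr_le => //; first exact: measurableU.
  by move=> x Ax; have [Bx|nBx] := pselect (B x); [left|right; left].
have h2 : mr i0 B <= mr i0 A + mr i0 (symdiff A B).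
  apply: le_trans (mrU i0 mA mS); apply: mr_le => //; first exact: measurableU.
  by move=> x Bx; have [Ax|nAx] := pselect (A x); [left|right; right].
have h3 := dominated i aB lam0.
have h4 : lam * mr i0 B <= lam * (mr i0 A + e / (lam + 1)).
  by rewrite ler_pM2l//; apply: le_trans h2 _; rewrite lerD2l.
have h5 := AB i.
have h6 : lam * (e / (lam + 1)) + e / (lam + 1) = e by field; rewrite gt_eqF.
rewrite mulrDr in h4; rewrite /mr in h1 h4 h5 *; lra.
Qed.

Let approximableC A : approximable A -> approximable (~` A).
Proof.
move=> [mA apA]; split; first exact: measurableC.
move=> eta eta0; have [B aB AB] := apA eta eta0.
exists (~` B); first exact: algC.
suff -> : symdiff (~` A) (~` B) = symdiff A B by [].
by rewrite /symdiff !setDE !setCK setUC (setIC B) (setIC A).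
Qed.

Let approximableU A B : approximable A -> approximable B -> approximable (A `|` B).
Proof.
move=> [mA apA] [mB apB]; split; first exact: measurableU.
move=> eta eta0; have eta2 : 0 < eta / 2 by rewrite divr_gt0.
have [A' aA' AA'] := apA _ eta2; have [B' aB' BB'] := apB _ eta2.
exists (A' `|` B'); first exact: algU.
move=> i; rewrite [leRHS](splitr eta).
apply: le_trans (lerD (AA' i) (BB' i)).
have mA' := alg_measurable aA'; have mB' := alg_measurable aB'.
apply: le_trans (mrU i _ _); [|exact: measurable_symdiff..].
apply: mr_le.
- by apply: measurable_symdiff; exact: measurableU.
- by apply: measurableU; exact: measurable_symdiff.
move=> x [[[Ax|Bx] /not_orP[nA nB]]|[[Ax|Bx] /not_orP[nA nB]]].
- by left; left.
- by right; left.
- by left; right.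
- by right; right.
Qed.

Let approximable0 : approximable set0.
Proof.
split=> // eta eta0; exists set0; first by rewrite -setCT; exact: algC.
move=> i; rewrite /symdiff set0D setU0 /mr measure0; exact: ltW.
Qed.

Let approximable_bigcup (F : (set T)^nat) : (forall n, approximable (F n)) ->
  approximable (\bigcup_n F n).
Proof.
move=> apF; have mF n : measurable (F n) by case: (apF n).
have mU : measurable (\bigcup_n F n) by exact: bigcupT_measurable.
split=> // eta eta0.
pose U n := \big[setU/set0]_(k < n) F k.
have apU n : approximable (U n).
  by apply: (big_ind approximable) => //; exact: approximableU.
have mUn n : measurable (U n) by case: (apU n).
have ndU : nondecreasing_seq U.
  by move=> a b ab; apply/subsetPset; exact: subset_bigsetU.
pose W := \bigcup_n F n.
have UW n : U n `<=` W by exact: bigsetU_bigcup.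
have WU x : W x -> exists n, U n x.
  by move=> [n _ Fnx]; exists n.+1; apply: bigsetU_sup Fnx; exact: ltnSn.
have mWU n : measurable (W `\` U n) by exact: measurableD.
(* This lam makes c / lam = eta / 4; the other eta / 4 of the bound on the tail
   comes from a tail that is small for the reference measure i0. *)
pose lam := 4 * c / eta; have lam0 : 0 < lam by rewrite divr_gt0// mulr_gt0.
have tail0 : mr i0 (W `\` U n) @[n --> \oo] --> 0.
  apply: fine_cvg; rewrite -[0%:E](measure0 (m i0)).
  have -> : set0 = \bigcap_n (W `\` U n).
    apply/esym; rewrite -subset0 => x H; have [Wx _] := H 0%N I.
    by have [n Unx] := WU _ Wx; have [_] := H n I.
  apply: nonincreasing_cvg_mu => //.
  - by rewrite ltey_eq fin_num_measure.
  - exact: bigcapT_measurable.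
  - move=> a b ab; apply/subsetPset => x [Wx nUx]; split => // Ux; apply: nUx.
    by move: x Ux {Wx}; apply/subsetPset; exact: ndU.
have [N HN] : exists N, mr i0 (W `\` U N) <= eta / (4 * lam).
  have e0 : 0 < eta / (4 * lam) by rewrite divr_gt0// mulr_gt0.
  move/cvgrPdist_le : tail0 => /(_ _ e0)[N _ /(_ N (leqnn N)) HN]; exists N.
  by move: HN; rewrite /= sub0r normrN ger0_norm// fine_ge0.
have tail i : mr i (W `\` U N) <= eta / 2.
  rewrite -lee_fin mrE//.
  have mUU n : measurable (U n `\` U N) by exact: measurableD.
  have -> : W `\` U N = \bigcup_n (U n `\` U N).
    apply/seteqP; split=> [x [/WU[n Ux] nU]|x [n _ [Ux nU]]].
      by exists n.
    by split => //; exact: (UW n).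
  have cvgU : (m i \o (fun n => U n `\` U N)) @ \oo --> m i (\bigcup_n (U n `\` U N)).
    apply: nondecreasing_cvg_mu => //; first exact: bigcupT_measurable.
    move=> a b ab; apply/subsetPset; apply: setSD.
    by apply/subsetPset; exact: ndU.
  rewrite -(cvg_lim _ cvgU)//; apply: lime_le; first by apply/cvg_ex; eexists; exact: cvgU.
  apply: nearW => n /=; rewrite -mrE// lee_fin.
  have apUU : approximable (U n `\` U N).
    rewrite setDE -[U n]setCK -setCU; apply/approximableC/approximableU => //.
    exact: approximableC.
  apply: le_trans (approx_dominated i apUU lam0) _.
  have h1 : mr i0 (U n `\` U N) <= eta / (4 * lam).
    by apply: le_trans HN; apply: mr_le => //; apply: setSD; exact: UW.
  have h2 : lam * mr i0 (U n `\` U N) <= lam * (eta / (4 * lam)) by rewrite ler_pM2l.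
  have h3 : lam * (eta / (4 * lam)) = eta / 4 by field; rewrite gt_eqF.
  have h4 : c / lam = eta / 4 by rewrite /lam; field; rewrite !gt_eqF.
  rewrite h4 -h3 in h2 *; lra.
have [B aB UB] := (apU N).2 (eta / 2) (divr_gt0 eta0 (ltr0n _ 2)).
exists B => // i; rewrite [leRHS](splitr eta).
apply: le_trans (lerD (tail i) (UB i)).
have mB := alg_measurable aB.
have mS := measurable_symdiff (mUn N) mB.

apply: le_trans (mrU i (mWU N) mS); apply: mr_le.
- exact: measurable_symdiff.
- exact: measurableU.
move=> x [[Fx nBx]|[Bx nFx]].
  have [Ux|nUx] := pselect (U N x); last by left.
  by right; left.
by right; right; split => // Ux; apply: nFx; exact: (UW N).
Qed.

(** The events that can be approximated uniformly in the index by elements of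
    alg form a sigma-algebra.  Only countable unions need an argument: the
    domination extends to events that can be approximated, hence to the tails of
    a union, which tend to the empty set for the reference measure i0 and are
    therefore small uniformly in the index.  The bound lam * m i0 A + c / lam is
    what a density with second moment at most c yields. *)
Lemma uniform_approximation A eta : measurable A -> 0 < eta ->
  exists2 B, alg B & forall i, fine (m i (symdiff A B)) <= eta.
Proof.
move=> mA eta0; suff [_] : approximable A by apply.
have : <<s alg >> A by exact: gen.
apply: smallest_sub; last first.
  move=> B aB; split; first exact: alg_measurable.
  move=> e e0; exists B => // i.
  by rewrite /symdiff setDv setU0 /mr measure0 ltW.
split => //.
- by move=> B; rewrite setTD; exact: approximableC.
Qed.

End uniform_approximation.

(** * Weak continuity of the error probabilities *)

Lemma ge0_integrable d (T : measurableType d) (R : realType)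
    (mu : {measure set T -> \bar R}) (f : T -> R) (c : R) :
  measurable_fun setT f -> (forall x, 0 <= f x) ->
  (\int[mu]_x (f x)%:E = c%:E)%E -> mu.-integrable setT (EFin \o f).
Proof.
move=> mf f0 fc; apply/integrableP; split; first exact/measurable_EFinP.
under eq_integral do rewrite /= ger0_norm//.
by rewrite fc ltry.
Qed.

Section continuous_real.
Context (R : realType) (T : topologicalType).
Implicit Types f g : T -> R.

Lemma continuous_fun_add f g : continuous f -> continuous g ->
  continuous (fun x => f x + g x).
Proof. by move=> cf cg x; exact: (@continuousD R R^o _ _ _ x (cf x) (cg x)). Qed.

Lemma continuous_fun_mul f g : continuous f -> continuous g ->
  continuous (fun x => f x * g x).
Proof. by move=> cf cg x; exact: (@continuousM R _ _ _ x (cf x) (cg x)). Qed.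

Lemma continuous_fun_sum n (F : nat -> T -> R) : (forall i, continuous (F i)) ->
  continuous (fun x => \sum_(i < n) F i x).
Proof.
move=> cF; elim: n => [|j IH].
  rewrite (_ : (fun _ => _) = cst 0); first exact: cst_continuous.
  by apply/funext => x; rewrite big_ord0.
rewrite (_ : (fun _ => _) = (fun x => \sum_(i < j) F i x + F j x)); last first.
  by apply/funext => x; rewrite big_ord_recr.
exact: continuous_fun_add.
Qed.

Lemma continuous_fun_exp f : continuous f -> continuous (fun x => expR (f x)).
Proof.
by move=> cf x; apply: (continuous_comp (cf x)); exact: continuous_expR.
Qed.

End continuous_real.

Lemma double_norm_le (R : realFieldType) (x eta : R) : 0 < eta ->
  2 * `|x| <= eta + eta^-1 * x ^+ 2.
Proof.
move=> eta0.
rewrite -(ler_pM2l eta0) mulrDr mulVKf ?gt_eqF// -(real_normK (num_real x)).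
have := sqr_ge0 (eta - `|x|); nra.
Qed.

Section weak_continuity.
Context d (Omega : measurableType d) (R : realType) (P : probability Omega R).
Variables (w : R -> Omega -> R) (hw : wiener_process P w) (eps : R).
Hypothesis eps0 : 0 < eps.
Notation mu01 := (@lebesgue01 R).
Notation sqint := (Lfun mu01 2%:E).
Notation sigp := (signal_path w eps).

Definition law f (C : set (path01 R)) : R := fine (P (sigp f @^-1` C)).

Lemma measurable_preimage_path f C : measurable C -> measurable (sigp f @^-1` C).
Proof.
move=> mC; rewrite -[X in measurable X]setTI.
exact: (measurable_signal_path hw eps f measurableT mC).
Qed.

Lemma lawE f C : measurable C -> (law f C)%:E = P (sigp f @^-1` C).
Proof.
by move=> mC; rewrite fineK// fin_num_measure//; exact: measurable_preimage_path.
Qed.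

(** The laws of the observations of a ball of signals are uniformly absolutely
    continuous with respect to pure noise: the second moment of the density
    is at most expR (M / eps ^+ 2), whatever the times of s. *)
Lemma law_dominated f s C M lam : f \in sqint -> ip f f <= M ->
  <<s cylinders s >> C -> 0 < lam ->
  law f C <= lam * law (cst 0) C + expR (M / eps ^+ 2) / lam.
Proof.
move=> hf fM sC lam0; have mC := cylinders_measurable sC.
have [Lam [n [k [h [mL LC LL hh LB]]]]] := grid_likelihood hw eps0 s.
have [mLf Lf0] := mL f.
have m0 := measurable_preimage_path (cst 0) mC.
rewrite -lee_fin EFinD EFinM !lawE// LC//.
have q0 x : 0 <= lam^-1 * (Lam f x * Lam f x).
  by apply: mulr_ge0; [rewrite invr_ge0 ltW|exact: mulr_ge0].
have hint : (\int[P]_omega (lam^-1 * (Lam f omega * Lam f omega))%:E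
    <= (expR (M / eps ^+ 2) / lam)%:E)%E.
  under eq_integral do rewrite EFinM.
  rewrite ge0_integralZl_EFin//; last 3 first.
  - by move=> x _; rewrite lee_fin mulr_ge0.
  - by apply/measurable_EFinP; exact: measurable_funM.
  - by rewrite invr_ge0 ltW.
  rewrite LL// -EFinM lee_fin mulrC ler_pM2r ?invr_gt0// ler_expR.
  rewrite (le_trans (LB _ hf))// ler_pM2r// invr_gt0 exprn_gt0//.
(* x <= lam + x ^ 2 / lam for every x, according as x <= lam or not. *)
apply: (@le_trans _ _ (\int[P]_(omega in sigp (cst 0%R) @^-1` C)
    (lam%:E + (lam^-1 * (Lam f omega * Lam f omega))%:E))%E).
  apply: ge0_le_integral => //.
  - by move=> x _; rewrite lee_fin.
  - by apply/measurable_EFinP; exact: measurable_funTS.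
  - apply/measurable_funTS/emeasurable_funD => //.
    by apply/measurable_EFinP; do 2 apply: measurable_funM => //.
  - move=> x _; rewrite -EFinD lee_fin.
    have [Ll|lL] := leP (Lam f x) lam.
      by rewrite (le_trans Ll)// lerDl q0.
    rewrite -(ler_pM2l lam0) mulrDr mulVKf ?gt_eqF//.
    have := mulr_gt0 lam0 lam0.
    have : lam * Lam f x <= Lam f x * Lam f x by rewrite ler_wpM2r// ltW.
    lra.
rewrite ge0_integralD//; last 3 first.
- by move=> x _; rewrite lee_fin ltW.
- by move=> x _; rewrite lee_fin q0.
- by apply/measurable_funTS/measurable_EFinP; do 2 apply: measurable_funM => //.
rewrite integral_cst// leeD//.
apply: le_trans hint; apply: ge0_subset_integral => //.
- by apply/measurable_EFinP; do 2 apply: measurable_funM => //.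
- by move=> x _; rewrite lee_fin q0.
Qed.

Lemma weak_ip_continuous h : h \in sqint ->
  continuous ((fun S => ip (L2_fun S) h) : weakL2 R -> R).
Proof.
move=> hh; have [g gh] := Lfun_L2 hh.
have -> : (fun S => ip (L2_fun S) h) = (fun S => L2_inner S g).
  apply/funext => S; rewrite /L2_inner /ip /Rintegral; congr fine.
  apply: ae_eq_integral => //.
  - apply/measurable_EFinP/measurable_funM; first exact: measurable_L2_fun.
    exact: sqint_measurable.
  - by apply/measurable_EFinP/measurable_funM; exact: measurable_L2_fun.
  - by apply: (@filterS _ _ (ae_filter_ringOfSetsType mu01) _ _ _ gh) => x /= -> _.
exact: weak_inner_continuous.
Qed.

(** The two probabilities differ by at most the L1 distance between the
    densities, which is controlled by their L2 distance; the square of the latter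
    is a weakly continuous function of S that vanishes at S0. *)
Lemma law_weak_cts_cylinder s C : <<s cylinders s >> C -> forall M,
  weak_cts_on (L2_ball M) (fun S => law (L2_fun S) C).
Proof.
move=> sC M S0 _ eta eta0; have mC := cylinders_measurable sC.
have [Lam [n [k [h [mL LC LL hh LB]]]]] := grid_likelihood hw eps0 s.
pose Q S T := \sum_(i < n) k i * (ip (L2_fun S) (h i) * ip (L2_fun T) (h i)).
(* V S is the squared distance in L2(P) between the densities of S and S0. *)
pose V S := expR (Q S S) - 2 * expR (Q S S0) + expR (Q S0 S0).
have cQ (T : L2 R) : continuous ((fun S => Q S T) : weakL2 R -> R).
  apply: (@continuous_fun_sum R (weakL2 R) n
    (fun i S => k i * (ip (L2_fun S) (h i) * ip (L2_fun T) (h i)))) => i; apply: continuous_fun_mul.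
    exact: cst_continuous.
  apply: continuous_fun_mul; first exact: weak_ip_continuous.
  exact: cst_continuous.
have cQ2 : continuous ((fun S => Q S S) : weakL2 R -> R).
  apply: (@continuous_fun_sum R (weakL2 R) n
    (fun i S => k i * (ip (L2_fun S) (h i) * ip (L2_fun S) (h i)))) => i; apply: continuous_fun_mul.
    exact: cst_continuous.
  by apply: continuous_fun_mul; exact: weak_ip_continuous.
have cV : continuous (V : weakL2 R -> R).
  apply: continuous_fun_add; last exact: cst_continuous.
  apply: continuous_fun_add; first exact: continuous_fun_exp.
  rewrite (_ : (fun _ => _) = (fun S : weakL2 R => - 2 * expR (Q S S0))).
    apply: continuous_fun_mul; first exact: cst_continuous.
    exact: continuous_fun_exp.
  by apply/funext => S; rewrite mulNr.
have V0 : V S0 = 0 by rewrite /V; lra.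
have eta20 : 0 < eta ^+ 2 by rewrite exprn_gt0.
have : nbhs (S0 : weakL2 R) [set S | V S < eta ^+ 2].
  have /cvgrPdist_lt/(_ _ eta20) H : V @ nbhs (S0 : weakL2 R) --> V S0 by exact: cV.
  apply: filterS H => S; rewrite V0 sub0r normrN /=.
  exact: le_lt_trans (ler_norm _).
move=> /weak_box_base[gs [e e0 sub]]; exists gs, e => // S _ /sub /= VS.
have hS := L2_fun_Lfun S; have hS0 := L2_fun_Lfun S0.
set f := L2_fun S; set f0 := L2_fun S0; set C0 := sigp (cst 0) @^-1` C.
have mC0 : measurable C0 by exact: measurable_preimage_path.
have iLL g g' : g \in sqint -> g' \in sqint ->
    P.-integrable setT (EFin \o (fun omega => Lam g omega * Lam g' omega)).
  move=> hg hg'; apply: (ge0_integrable _ _ (LL _ _ hg hg')).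
    by apply: measurable_funM; [case: (mL g)|case: (mL g')].
  by move=> x; apply: mulr_ge0; [case: (mL g)|case: (mL g')].
have iL g : g \in sqint -> P.-integrable setT (EFin \o Lam g).
  move=> hg; have [mg g0] := mL g; apply: (@ge0_integrable _ _ _ _ _ 1) => //.
  have := LC g setT hg (@measurableT _ (g_sigma_algebraType (cylinders s))).
  by rewrite !preimage_setT probability_setT => <-.
have RLL g g' : g \in sqint -> g' \in sqint ->
    \int[P]_omega (Lam g omega * Lam g' omega) =
    expR (\sum_(i < n) k i * (ip g (h i) * ip g' (h i))).
  by move=> hg hg'; rewrite /Rintegral LL.
pose D omega := Lam f omega - Lam f0 omega.
have DE : law f C - law f0 C = \int[P]_(omega in C0) D omega.
  rewrite /law !(LC _ C)// RintegralB//.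
    by apply: integrableS (iL _ hS).
  by apply: integrableS (iL _ hS0).
have iD : P.-integrable setT (EFin \o D).
  by apply: (integrableB _ (iL _ hS) (iL _ hS0)).
have D2E omega : D omega ^+ 2 = Lam f omega * Lam f omega -
   2 * (Lam f omega * Lam f0 omega) + Lam f0 omega * Lam f0 omega.
  by rewrite /D; ring.
have i2 : P.-integrable setT (EFin \o (fun omega => 2 * (Lam f omega * Lam f0 omega))).
  by have := integrableZl measurableT 2 (iLL _ _ hS hS0).
have i12 : P.-integrable setT (EFin \o (fun omega => Lam f omega * Lam f omega -
   2 * (Lam f omega * Lam f0 omega))).
  by have := integrableB measurableT (iLL _ _ hS hS) i2.
have iD2 : P.-integrable setT (EFin \o (fun omega => D omega ^+ 2)).
  have := integrableD measurableT i12 (iLL _ _ hS0 hS0).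
  by apply: eq_integrable => // x _; rewrite /= D2E.
have RD2 : \int[P]_omega (D omega ^+ 2) = V S.
  under eq_Rintegral do rewrite D2E.
  rewrite RintegralD// ?RintegralB// ?RintegralZl// ?RLL//; exact: iLL.
have iZD2 : P.-integrable setT (EFin \o (fun omega => eta^-1 * D omega ^+ 2)).
  by have := integrableZl measurableT eta^-1 iD2.
have ibd : P.-integrable setT (EFin \o (fun omega => eta + eta^-1 * D omega ^+ 2)).
  have := integrableD measurableT
    (finite_measure_integrable_cst P eta measurableT) iZD2.
  by [].
have main : 2 * `|\int[P]_(omega in C0) D omega| <=
    \int[P]_omega (eta + eta^-1 * D omega ^+ 2).
  have iD' : P.-integrable setT (EFin \o (D \_ C0)).
    rewrite (_ : _ \o _ = (EFin \o D) \_ C0); last first.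
      by apply/funext => x /=; rewrite !patchE; case: ifP.
    by apply/(integrable_mkcond _ mC0).1; exact: integrableS iD.
  have iN := integrable_norm iD'.
  rewrite Rintegral_mkcond.
  apply: (@le_trans _ _ (2 * \int[P]_omega `|(D \_ C0) omega|)).
    by rewrite ler_pM2l//; exact: le_normr_Rintegral.
  rewrite -RintegralZl//; apply: le_Rintegral => //.
    by have := integrableZl measurableT 2 iN.
  move=> x _.
  apply: le_trans (double_norm_le (D x) eta0).
  rewrite ler_pM2l// patchE; case: ifP => // _.
  by rewrite normr0.
rewrite -/f -/f0 DE -(ltr_pM2l (_ : 0 < 2))//; apply: le_lt_trans main _.
have icst : P.-integrable setT (EFin \o (fun=> eta)).
  by have := finite_measure_integrable_cst P eta measurableT.
rewrite RintegralD//.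
rewrite RintegralZl// RD2 Rintegral_cst// [fine (P _)](_ : _ = 1); last first.
  by rewrite probability_setT.
rewrite mulr1 [ltRHS]mulr_natl mulr2n ltrD2l ltr_pdivrMl//.
Qed.

End weak_continuity.

Section weak_cts_on_closure.
Variables (R : realType) (D : set (L2 R)).

Lemma weak_cts_onD f g : weak_cts_on D f -> weak_cts_on D g ->
  weak_cts_on D (fun S => f S + g S).
Proof.
move=> cf cg S0 D0 eta eta0; have eta2 : 0 < eta / 2 by rewrite divr_gt0.
have [g1 [e1 e10 H1]] := cf S0 D0 _ eta2.
have [g2 [e2 e20 H2]] := cg S0 D0 _ eta2.
exists (g1 ++ g2), (Num.min e1 e2); first by rewrite lt_min e10.
move=> S DS HS.
have h1 : `|f S - f S0| < eta / 2.
  apply: H1 => // h hg; have := HS h; rewrite mem_cat hg lt_min.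
  by move=> /(_ isT) /andP[].
have h2 : `|g S - g S0| < eta / 2.
  apply: H2 => // h hg; have := HS h; rewrite mem_cat hg orbT lt_min.
  by move=> /(_ isT) /andP[].
have -> : f S + g S - (f S0 + g S0) = (f S - f S0) + (g S - g S0) by ring.
rewrite (splitr eta); apply: le_lt_trans (ler_normD _ _) _.
exact: ltrD.
Qed.

Lemma weak_cts_on_cst (c : R) : weak_cts_on D (fun=> c).
Proof.
by move=> S0 D0 eta eta0; exists [::], 1 => // S _ _; rewrite subrr normr0.
Qed.

Lemma weak_cts_onZ (c : R) f : weak_cts_on D f -> weak_cts_on D (fun S => c * f S).
Proof.
move=> cf S0 D0 eta eta0.
have c1 : 0 < `|c| + 1 by rewrite ltr_wpDl.
have [g1 [e1 e10 H1]] := cf S0 D0 _ (divr_gt0 eta0 c1).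
exists g1, e1 => // S DS HS; rewrite -mulrBr normrM.
apply: le_lt_trans (_ : (`|c| + 1) * `|f S - f S0| < eta).
  by rewrite ler_wpM2r// lerDl.
by rewrite mulrC -ltr_pdivlMr//; exact: H1.
Qed.

Lemma weak_cts_on_sum n (F : nat -> L2 R -> R) :
  (forall i, weak_cts_on D (F i)) -> weak_cts_on D (fun S => \sum_(i < n) F i S).
Proof.
move=> cF; elim: n => [|n IH].
  under eq_fun do rewrite big_ord0; exact: weak_cts_on_cst.
by under eq_fun do rewrite big_ord_recr/=; exact: weak_cts_onD.
Qed.

Lemma weak_cts_on_approx f :
  (forall eta, 0 < eta -> exists2 g, weak_cts_on D g &
    forall S, D S -> `|f S - g S| <= eta) -> weak_cts_on D f.
Proof.
move=> H S0 D0 eta eta0; have eta3 : 0 < eta / 3 by rewrite divr_gt0.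
have [g cg fg] := H _ eta3.
have [g1 [e1 e10 H1]] := cg S0 D0 _ eta3.
exists g1, e1 => // S DS HS.
have h1 := fg S DS; have h2 := fg S0 D0; have h3 := H1 S DS HS.
have -> : f S - f S0 = (f S - g S) + (g S - g S0) - (f S0 - g S0) by ring.
apply: le_lt_trans (ler_normB _ _) _.
have := ler_normD (f S - g S) (g S - g S0); lra.
Qed.

End weak_cts_on_closure.

Section error_continuity.
Context d (Omega : measurableType d) (R : realType) (P : probability Omega R).
Variables (w : R -> Omega -> R) (hw : wiener_process P w) (eps : R).
Hypothesis eps0 : 0 < eps.
Notation mu01 := (@lebesgue01 R).
Notation sqint := (Lfun mu01 2%:E).
Notation sigp := (signal_path w eps).
Notation law := (law P w eps).

(** The events that depend on finitely many times; unlike the events of a fixed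
    grid they generate all events, and they still form an algebra. *)
Definition finite_cylinders : set (set (path01 R)) :=
  [set C | exists s, <<s cylinders s >> C].

Lemma cylinders_le s s' : {subset s <= s'} ->
  <<s @cylinders R s >> `<=` <<s cylinders s' >>.
Proof.
move=> ss'; apply: sub_smallest2r; first exact: smallest_sigma_algebra.
by move=> _ [t [B [/ss' ts mB ->]]]; exists t, B.
Qed.

Lemma law_weak_cts C M : measurable C ->
  weak_cts_on (L2_ball M) (fun S => law (L2_fun S) C).
Proof.
move=> mC; have [M0|M0] := ltP M 0.
  move=> S0; rewrite /L2_ball/= => h.
  by have := le_lt_trans h M0; rewrite ltNge ip_ge0.
have zs : (cst 0 : R -> R) \in sqint by exact: Lfun_cst.
have z0 : ip (cst 0 : R -> R) (cst 0) <= M.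
  by rewrite /ip; under eq_Rintegral do rewrite mul0r; rewrite Rintegral_cst// mul0r.
pose J := {f : R -> R | f \in sqint /\ ip f f <= M}.
pose sp (f : R -> R) : {mfun Omega >-> path01 R} := HB.pack (sigp f)
  (isMeasurableFun.Build _ _ _ _ _ (measurable_signal_path hw eps f)).
pose m (j : J) : probability (path01 R) R := distribution P (sp (sval j)).
pose i0 : J := exist _ (cst 0) (conj zs z0).
have approx := @uniform_approximation _ (path01 R) R J m i0 finite_cylinders
  (expR (M / eps ^+ 2)).
apply: weak_cts_on_approx => eta eta0.
have [|||||||B [s sB] CB] := approx _ _ _ _ _ _ _ C eta mC eta0.
- by move=> A [s sA]; exact: cylinders_measurable sA.
- move=> A [s sA]; exists s.
  exact: (@measurableC _ (g_sigma_algebraType (cylinders s))).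
- move=> A A' [s sA] [s' sA']; exists (s ++ s').
  apply: (@measurableU _ (g_sigma_algebraType (cylinders (s ++ s')))).
    by apply: cylinders_le sA => t ts; rewrite mem_cat ts.
  by apply: cylinders_le sA' => t ts; rewrite mem_cat ts orbT.
- by exists [::]; exact: (@measurableT _ (g_sigma_algebraType (cylinders [::]))).
- apply: sub_smallest2r; first exact: smallest_sigma_algebra.
  move=> _ [t [A [mA ->]]]; exists [:: sval t]; apply: sub_sigma_algebra.
  by exists t, A; split=> //; rewrite mem_head.
- exact: expR_gt0.
- move=> [f [hf fM]] A lam [s sA] lam0; exact: (law_dominated hw eps0 hf fM sA lam0).
have mB := cylinders_measurable sB.
exists (fun S => law (L2_fun S) B); first exact: (law_weak_cts_cylinder hw eps0 sB).
move=> S DS; have := CB (exist _ (L2_fun S) (conj (L2_fun_Lfun S) DS)).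
set j := exist _ _ _ => CBj.
have mS := measurable_symdiff mC mB.
have le1 A A' : measurable A -> measurable A' -> A `<=` A' `|` symdiff C B ->
    fine (m j A) <= fine (m j A') + fine (m j (symdiff C B)).
  move=> mA mA' sub; rewrite -lee_fin EFinD !fineK ?fin_num_measure//.
  apply: le_trans (measureU2 _ mA' mS); rewrite le_measure ?inE//.
  exact: measurableU.
have h1 : law (L2_fun S) C <= law (L2_fun S) B + fine (m j (symdiff C B)).
  apply: le1 => // y Cy; have [By|nBy] := pselect (B y); [by left|right; by left].
have h2 : law (L2_fun S) B <= law (L2_fun S) C + fine (m j (symdiff C B)).
  apply: le1 => // y By; have [Cy|nCy] := pselect (C y); [by left|right; by right].
rewrite ler_norml; apply/andP; split; lra.
Qed.

(** The sum counts the levels 1, ..., n that are at most x; applied to n times a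
    test, it writes the test up to 1 / n as a mean of n indicators. *)
Lemma count_levels (n : nat) (x : R) : 0 <= x <= n%:R ->
  x - 1 <= \sum_(j < n) (j.+1%:R <= x)%R%:R <= x.
Proof.
elim: n x => [|n IH] x /andP[x0 xn].
  by rewrite big_ord0; apply/andP; split; lra.
rewrite big_ord_recr/=; have [xln|nx] := leP x n%:R.
  have -> : (n.+1%:R <= x) = false.
    by apply/negbTE; rewrite -ltNge (le_lt_trans xln)// ltr_nat.
  by rewrite addr0; apply: IH; rewrite x0.
rewrite (eq_bigr (fun=> 1)); last first.
  move=> i _; rewrite (_ : _ <= x)// ltW// (le_lt_trans _ nx)// ler_nat.
  exact: ltn_ord.
rewrite sumr_const card_ord; have := xn; rewrite -natr1.
by case: (leP (n%:R + 1) x) => /= h1 h2; apply/andP; split; lra.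
Qed.

Definition mean (k : path01 R -> R) (f : R -> R) : R :=
  fine ('E_P[fun omega => k (sigp f omega)])%E.

Lemma integrable01 (f : Omega -> R) : measurable_fun setT f ->
  (forall x, 0 <= f x <= 1) -> P.-integrable setT (EFin \o f).
Proof.
move=> mf f01.
apply: le_integrable (finite_measure_integrable_cst P 1 measurableT) => //.
  exact/measurable_EFinP.
move=> x _ /=; rewrite normr1 lee_fin.
by have /andP[f0 f1] := f01 x; rewrite ger0_norm.
Qed.

(** A test is the uniform limit of means of indicators of its upper level
    sets. *)
Lemma mean_weak_cts (k : path01 R -> R) M : measurable_fun setT k ->
  (forall y, 0 <= k y <= 1) ->
  weak_cts_on (L2_ball M) (fun S => mean k (L2_fun S)).
Proof.
move=> mk k01; apply: weak_cts_on_approx => eta eta0.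
have [n n1] : exists n : nat, n.+1%:R^-1 <= eta.
  exists (Num.truncn eta^-1); have etaV : 0 < eta^-1 by rewrite invr_gt0.
  rewrite -[leRHS]invrK lef_pV2 ?posrE// ltW//.
  by have /andP[] := truncn_itv (ltW etaV).
pose N := n.+1; have N0 : 0 < N%:R :> R by rewrite ltr0n.
pose C (j : nat) := [set y | j.+1%:R <= N%:R * k y].
have mC j : measurable (C j).
  rewrite -[C j]setTI; apply: (measurable_fun_le measurableT) => //.
  exact: measurable_funM.
exists (fun S => \sum_(j < N) N%:R^-1 * law (L2_fun S) (C j)).
  apply: (@weak_cts_on_sum _ _ N (fun j S => N%:R^-1 * law (L2_fun S) (C j))) => j.
  by apply: weak_cts_onZ; exact: law_weak_cts.
move=> S _; set f := L2_fun S.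
pose kN (y : path01 R) : R := \sum_(j < N) N%:R^-1 * \1_(C j) y.
have kNk y : k y - N%:R^-1 <= kN y <= k y.
  have Nk : 0 <= N%:R * k y <= N%:R.
    by have /andP[k0 k1] := k01 y; rewrite mulr_ge0 ?ler_piMr// ltW.
  have := count_levels Nk; rewrite /kN -mulr_sumr.
  have -> : \sum_(j < N) (j.+1%:R <= N%:R * k y)%R%:R = \sum_(j < N) \1_(C j) y :> R.
    apply: eq_bigr => j _; rewrite indicE; congr (nat_of_bool _)%:R.
    by apply/idP/idP => [?|/set_mem//]; exact/mem_set.
  move=> /andP[h1 h2]; apply/andP; split.
    by rewrite -(ler_pM2l N0) mulrBr mulVKf ?gt_eqF// divff ?gt_eqF.
  by rewrite -(ler_pM2l N0) mulVKf ?gt_eqF.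
have kN0 y : 0 <= kN y.
  by apply: sumr_ge0 => j _; rewrite mulr_ge0// invr_ge0 ltW.
have mkN : measurable_fun setT kN.
  by apply: measurable_sum => j; apply: measurable_funM => //; exact: measurable_indic.
have mf := measurable_signal_path hw eps f.
have mkf : measurable_fun setT (k \o sigp f) by exact: measurableT_comp.
have mkNf : measurable_fun setT (kN \o sigp f) by exact: measurableT_comp.
have ik : P.-integrable setT (EFin \o (k \o sigp f)) by apply: integrable01 => // x; exact: k01.
have ikN : P.-integrable setT (EFin \o (kN \o sigp f)).
  apply: integrable01 => // x /=; rewrite kN0/=.
  have /andP[_ h1] := kNk (sigp f x); have /andP[_ h2] := k01 (sigp f x).
  exact: le_trans h1 h2.
have iV : P.-integrable setT (EFin \o (fun=> N%:R^-1 : R)).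
  by have := finite_measure_integrable_cst P (N%:R^-1) measurableT.
have lawsum : \int[P]_omega (kN (sigp f omega)) =
    \sum_(j < N) N%:R^-1 * law f (C j).
  rewrite /Rintegral /kN; under eq_integral do rewrite -sumEFin.
  rewrite (@ge0_integral_sum _ _ _ P setT measurableT 'I_N
    (fun j omega => (N%:R^-1 * \1_(C j) (sigp f omega))%:E)); last 2 first.
  - move=> j; apply/measurable_EFinP/measurable_funM => //.
    by apply: measurableT_comp => //; exact: measurable_indic.
  - by move=> j x _; rewrite lee_fin mulr_ge0// invr_ge0 ltW.
  rewrite -[RHS]/(fine (_%:E)) -sumEFin; congr fine; apply: eq_bigr => j _.
  under eq_integral do rewrite EFinM.
  rewrite ge0_integralZl_EFin//; last first.
  - by apply/measurable_EFinP/measurableT_comp => //; exact: measurable_indic.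
  rewrite EFinM lawE//; congr (_ * _)%E.
  rewrite -[LHS]/(\int[P]_omega (\1_(sigp f @^-1` C j) omega)%:E)%E.
  have mSC := measurable_preimage_path hw eps f (mC j).
  by rewrite integral_indic// setIT.
have meanE : mean k f = \int[P]_omega (k (sigp f omega)).
  by rewrite /mean unlock.
rewrite meanE -lawsum.
have h1 : \int[P]_omega (kN (sigp f omega)) <= \int[P]_omega (k (sigp f omega)).
  by apply: le_Rintegral => // x _ /=; have /andP[] := kNk (sigp f x).
have h2 : \int[P]_omega (k (sigp f omega)) <=
    \int[P]_omega (kN (sigp f omega)) + N%:R^-1.
  have e1 : N%:R^-1 = \int[P]_omega (N%:R^-1 : R).
    rewrite Rintegral_cst// [X in fine X](_ : _ = 1%E) ?mulr1//.
    exact: probability_setT.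
  rewrite [X in _ + X]e1 -RintegralD//; apply: le_Rintegral => //.
    by have := integrableD measurableT ikN iV.
  by move=> x _; rewrite -lerBlDr; have /andP[] := kNk (sigp f x).
have n1N : N%:R^-1 <= eta := n1.
by rewrite ler_norml; apply/andP; split; lra.
Qed.

End error_continuity.

(** * From tests to sets *)

Section L2_bounded_ball.
Variable R : realType.

Lemma L2_bounded_ball (A : set (L2 R)) : L2_bounded A ->
  exists M, A `<=` L2_ball M.
Proof.
move=> [M AM]; exists (M ^+ 2) => S AS.
have NM := AM _ AS.
have M0 : 0 <= M by rewrite -lee_fin (le_trans (Lnorm_ge0 _ _ _) NM).
rewrite /L2_ball/= -lee_fin L2_inner_ip.
have hS := L2_fun_Lfun S.
have -> : (ip (L2_fun S) (L2_fun S))%:E =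
    (\int[@lebesgue01 R]_x (L2_fun S x * L2_fun S x)%:E)%E.
  rewrite fineK//; apply: integrable_fin_num => //; exact: integrableM_sqint.
have -> : (\int[@lebesgue01 R]_x (L2_fun S x * L2_fun S x)%:E =
    'N[@lebesgue01 R]_2%:E[EFin \o L2_fun S] `^ 2)%E.
  rewrite powR_Lnorm//; apply: eq_integral => x _ /=.
  by rewrite powR_mulrn// real_normK ?num_real// expr2.
have -> : (M ^+ 2)%:E = (M%:E `^ 2)%E by rewrite poweR_EFin powR_mulrn.
by apply: gt0_ler_poweR => //; rewrite in_itv/= leey ?Lnorm_ge0 ?lee_fin ?M0.
Qed.

End L2_bounded_ball.

Section tests_to_sets.
Context d (Omega : measurableType d) (R : realType) (P : probability Omega R).
Variables (w : R -> Omega -> R) (hw : wiener_process P w).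
Implicit Types (K : R -> path01 R -> R) (S : L2 R).

Lemma err1_mean K S eps : err1 P w K S eps = mean P w eps (K eps) (L2_fun S).
Proof. reflexivity. Qed.

Lemma err2_mean K S eps :
  err2 P w K S eps = mean P w eps (fun y => 1 - K eps y) (L2_fun S).
Proof. by []. Qed.

Lemma is_test_complement (k : path01 R -> R) :
  is_test k -> is_test (fun y => 1 - k y).
Proof.
move=> [mk k01]; split; first exact: measurable_funB.
by move=> y; have /andP[k0 k1] := k01 y; apply/andP; split; lra.
Qed.

Lemma mean_complement eps (k : path01 R -> R) f : is_test k ->
  mean P w eps (fun y => 1 - k y) f = 1 - mean P w eps k f.
Proof.
move=> [mk k01]; rewrite /mean unlock.
have mkf : measurable_fun setT (k \o signal_path w eps f).
  by apply: measurableT_comp => //; exact: (measurable_signal_path hw eps f).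
have i1 : P.-integrable setT (EFin \o (fun=> 1 : R)).
  by have := finite_measure_integrable_cst P 1 measurableT.
have ik : P.-integrable setT (EFin \o (k \o signal_path w eps f)).
  by apply: integrable01 => // x; exact: k01.
rewrite -[LHS]/(\int[P]_omega (1 - (k \o signal_path w eps f) omega)).
rewrite RintegralB// Rintegral_cst// mul1r; congr (_ - _).
by rewrite [X in fine X = _](_ : _ = 1%E)//; exact: probability_setT.
Qed.

Lemma mean01 eps (k : path01 R -> R) f : is_test k -> 0 <= mean P w eps k f <= 1.
Proof.
move=> tk; have h (k' : path01 R -> R) : is_test k' -> 0 <= mean P w eps k' f.
  move=> [mk' k'01]; rewrite /mean unlock; apply: fine_ge0.
  apply: integral_ge0 => x _; rewrite lee_fin.
  by have /andP[] := k'01 (signal_path w eps f x).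
have := h _ (is_test_complement tk); rewrite mean_complement// subr_ge0 => ->.
by rewrite h.
Qed.

Notation harm := (fun k : nat => k.+1%:R^-1 : R).

(** For the ball M the errors are weakly continuous, hence this set is weakly
    closed.  With M and N both equal to n, each signal whose error tends to 0
    belongs to it for large n. *)
Definition small_error_set (k : nat -> path01 R -> R) (M : R) (N : nat) : set (L2 R) :=
  \bigcap_(j in [set j | (N <= j)%N])
    [set S | L2_ball M S /\ mean P w (harm j) (k j) (L2_fun S) <= 3^-1].

Lemma small_error_set_closed k M N : (forall j, is_test (k j)) ->
  closed (small_error_set k M N : set (weakL2 R)).
Proof.
move=> tk; apply: closed_bigI => j _; have [mk k01] := tk j.
apply: weak_cts_closed; first exact: L2_ball_closed.
by apply: mean_weak_cts => //; rewrite invr_gt0.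
Qed.

Lemma small_error_set_Fsigma k : (forall j, is_test (k j)) ->
  Fsigma (\bigcup_n small_error_set k n%:R n : set (weakL2 R)).
Proof.
move=> tk; exists (fun n => small_error_set k n%:R n) => // n.
exact: small_error_set_closed.
Qed.

Lemma cvg_harm (f : R -> R) :
  f eps @[eps --> 0^'+] --> (0 : R) -> f (harm j) @[j --> \oo] --> (0 : R).
Proof.
move=> /cvg_at_rightP; apply; split; first by move=> n; rewrite invr_gt0.
exact: cvg_harmonic.
Qed.

Lemma small_error_set_cvg k S :
  mean P w (harm j) (k j) (L2_fun S) @[j --> \oo] --> (0 : R) ->
  (\bigcup_n small_error_set k n%:R n) S.
Proof.
have e0 : 0 < 3^-1 :> R by rewrite invr_gt0.
move=> /cvgrPdist_le/(_ _ e0)[N _ HN].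
exists (maxn N (Num.truncn (L2_inner S S)).+1) => // j /= Nj; split.
  rewrite /L2_ball/=; have /andP[_ /ltW h] := truncn_itv (ip_ge0 (L2_fun S)).
  by apply: le_trans h _; rewrite ler_nat leq_maxr.
have := HN j (leq_trans (leq_maxl _ _) Nj); rewrite /= sub0r normrN.
exact: le_trans (ler_norm _).
Qed.

(** At a common index the two errors would be at most 1 / 3, whereas they add up
    to 1. *)
Lemma small_error_set_disjoint k M N : (forall j, is_test (k j)) ->
  small_error_set k M N `&`
  (\bigcup_n small_error_set (fun j y => 1 - k j y) n%:R n) = set0.
Proof.
move=> tk; rewrite -subset0 => S [H [n _ H']].
have [_ h] := H (maxn N n) (leq_maxl _ _).
have [_ h'] := H' (maxn N n) (leq_maxr _ _).
by rewrite mean_complement// in h'; lra.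
Qed.

Lemma consistent_separated (Theta0 Theta1 : set (L2 R)) K :
  L2_bounded Theta0 -> consistent P w Theta0 Theta1 K ->
  exists A B : set (weakL2 R),
    [/\ closed A, Fsigma B, Theta0 `<=` A, Theta1 `<=` B & A `&` B = set0].
Proof.
move=> /L2_bounded_ball[M T0M] [tK c0 c1].
pose k j := K (harm j).
have tk j : is_test (k j) by apply: tK; rewrite invr_gt0.
have e0 : 0 < 3^-1 :> R by rewrite invr_gt0.
have /cvg_harm/cvgrPdist_le/(_ _ e0)[N _ HN] := c0.
exists (small_error_set k M N).
exists (\bigcup_n small_error_set (fun j y => 1 - k j y) n%:R n); split.
- exact: small_error_set_closed.
- by apply: small_error_set_Fsigma => j; exact: is_test_complement.
- move=> S T0S j Nj; split; first exact: T0M.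
  have := HN j Nj; rewrite /= sub0r normrN => /(le_trans (ler_norm _)).
  apply: le_trans; apply: ub_le_sup.
    exists 1 => _ [S' _ <-]; rewrite err1_mean.
    by have /andP[] := mean01 (harm j) (L2_fun S') (tk j).
  by exists S.
- by move=> S /c1/cvg_harm cS; exact: small_error_set_cvg.
- exact: small_error_set_disjoint.
Qed.

Lemma pointwise_consistent_separated (Theta0 Theta1 : set (L2 R)) K :
  pointwise_consistent P w Theta0 Theta1 K ->
  exists A B : set (weakL2 R),
    [/\ Fsigma A, Fsigma B, Theta0 `<=` A, Theta1 `<=` B & A `&` B = set0].
Proof.
move=> [tK c0 c1].
pose k j := K (harm j).
have tk j : is_test (k j) by apply: tK; rewrite invr_gt0.
exists (\bigcup_n small_error_set k n%:R n).
exists (\bigcup_n small_error_set (fun j y => 1 - k j y) n%:R n); split.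
- exact: small_error_set_Fsigma.
- by apply: small_error_set_Fsigma => j; exact: is_test_complement.
- by move=> S /c0/cvg_harm cS; exact: small_error_set_cvg.
- by move=> S /c1/cvg_harm cS; exact: small_error_set_cvg.
- rewrite setI_bigcupl; apply: bigcup0 => n _.
  exact: small_error_set_disjoint.
Qed.

End tests_to_sets.

(** * Density of step functions *)

Section step_density.
Variable R : realType.
Notation leb := (@lebesgue_measure R).
Notation mu01 := (@lebesgue01 R).
Notation sqint := (Lfun mu01 2%:E).
Implicit Types f g h : R -> R.

(** Every rational of (0, 1) occurs among these times; other codes are sent to
    1 / 2, so that all the times lie in (0, 1). *)
Definition rat01 (i : nat) : R :=
  if unpickle i is Some r then (if 0 < (ratr r : R) < 1 then ratr r else 2^-1)
  else 2^-1.

Lemma rat01_itv i : 0 < rat01 i < 1.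
Proof.
have h : 0 < (2^-1 : R) < 1 by rewrite invr_gt0 ltr0n invf_lt1 ?ltr1n ?ltr0n.
by rewrite /rat01; case: unpickle => //= r; case: ifP.
Qed.

Lemma rat01_dense (a b : R) : 0 <= a -> a < b -> b <= 1 ->
  exists i, a < rat01 i < b.
Proof.
move=> a0 ab b1; have [r] := rat_in_itvoo ab; rewrite in_itv/= => /andP[ar rb].
exists (pickle r); rewrite /rat01 pickleK.
by rewrite (le_lt_trans a0 ar) (lt_le_trans rb b1) /= ar.
Qed.

Definition sqdist f g := ip (fun x => f x + -1 * g x) (fun x => f x + -1 * g x).

Definition step (l : seq (R * nat)) : R -> R :=
  fun x => \sum_(p <- l) p.1 * \1_(`]0, rat01 p.2]%classic) x.

Lemma sqint_step l : step l \in sqint.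
Proof.
by apply: sqint_sum => p; apply: sqintZ; apply: sqint_indic; exact: measurable_itv.
Qed.

Definition step_limit f := forall eta, 0 < eta -> exists l, sqdist f (step l) <= eta.

Lemma ip_sqD_le f g : f \in sqint -> g \in sqint ->
  ip (fun x => f x + g x) (fun x => f x + g x) <= 2 * ip f f + 2 * ip g g.
Proof.
move=> hf hg; have := ip_ge0 (fun x => f x + -1 * g x).
rewrite ip_sqD//.
have -> : (fun x => f x + g x) = (fun x => f x + 1 * g x).
  by apply/funext => x; rewrite mul1r.
rewrite ip_sqD//; lra.
Qed.

Lemma step_limit_close f : f \in sqint ->
  (forall eta, 0 < eta -> exists g, [/\ g \in sqint, step_limit g & sqdist f g <= eta]) ->
  step_limit f.
Proof.
move=> hf H eta eta0; have e4 : 0 < eta / 4 by rewrite divr_gt0.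
have [g [hg Lg fg]] := H _ e4; have [l gl] := Lg _ e4.
exists l; rewrite /sqdist.
have -> : (fun x => f x + -1 * step l x) =
    (fun x => (f x + -1 * g x) + (g x + -1 * step l x)).
  by apply/funext => x; ring.
apply: le_trans (ip_sqD_le _ _) _.
- by apply: sqintD => //; exact: sqintZ.
- by apply: sqintD => //; apply: sqintZ; exact: sqint_step.
rewrite /sqdist in fg gl; lra.
Qed.

Lemma step_limitD f g : f \in sqint -> g \in sqint -> step_limit f -> step_limit g ->
  step_limit (fun x => f x + g x).
Proof.
move=> hf hg Lf Lg eta eta0; have e4 : 0 < eta / 4 by rewrite divr_gt0.
have [l fl] := Lf _ e4; have [m gm] := Lg _ e4.
exists (l ++ m); rewrite /sqdist.
have -> : (fun x => f x + g x + -1 * step (l ++ m) x) =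
    (fun x => (f x + -1 * step l x) + (g x + -1 * step m x)).
  by apply/funext => x; rewrite /step big_cat/=; ring.
apply: le_trans (ip_sqD_le _ _) _.
- by apply: sqintD => //; apply: sqintZ; exact: sqint_step.
- by apply: sqintD => //; apply: sqintZ; exact: sqint_step.
rewrite /sqdist in fl gm; lra.
Qed.

Lemma step_limitZ a f : f \in sqint -> step_limit f -> step_limit (fun x => a * f x).
Proof.
move=> hf Lf eta eta0; have a1 : 0 < a ^+ 2 + 1 by rewrite ltr_wpDl// sqr_ge0.
have [l fl] := Lf _ (divr_gt0 eta0 a1).
exists [seq (a * p.1, p.2) | p <- l]; rewrite /sqdist.
have hd : (fun x => f x + -1 * step l x) \in sqint.
  by apply: sqintD => //; apply: sqintZ; exact: sqint_step.
have -> : (fun x => a * f x + -1 * step [seq (a * p.1, p.2) | p <- l] x) =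
    (fun x => a * (f x + -1 * step l x)).
  apply/funext => x; rewrite /step big_map mulrDr mulrCA !big_distrr/=.
  congr (_ + _); apply: eq_bigr => p _ /=; ring.
rewrite ipZl ?sqintZ// ipZr// mulrA -expr2.
rewrite /sqdist ler_pdivlMr// in fl; apply: le_trans fl; rewrite mulrC ler_wpM2l ?ip_ge0//.
by rewrite lerDl.
Qed.

Lemma step_limit_sum n (F : nat -> R -> R) : (forall i, F i \in sqint) ->
  (forall i, step_limit (F i)) -> step_limit (fun x => \sum_(i < n) F i x).
Proof.
move=> hF LF; elim: n => [|n IH].
  move=> eta eta0; exists [::]; rewrite /sqdist.
  have -> : (fun x => \sum_(i < 0) F i x + -1 * step [::] x) = (fun x => 0 * F 0%N x).
    by apply/funext => x; rewrite big_ord0 /step big_nil; ring.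
  by rewrite ipZl ?sqintZ// mul0r ltW.
rewrite (_ : (fun _ => _) = (fun x => \sum_(i < n) F i x + F n x)); last first.
  by apply/funext => x; rewrite big_ord_recr.
apply: step_limitD => //.
exact: (sqint_sum (index_enum 'I_n) (fun i => hF (nat_of_ord i))).
Qed.

Lemma sqdist_indic (A B : set R) : measurable A -> measurable B ->
  sqdist \1_A \1_B = fine (mu01 (symdiff A B)).
Proof.
move=> mA mB; have mS := measurable_symdiff mA mB.
transitivity (fine (\int[mu01]_x (\1_(symdiff A B) x)%:E)%E); last first.
  by rewrite integral_indic// setIT.
congr fine; apply: eq_integral => x _; congr EFin; rewrite !indicE.
have -> : (x \in symdiff A B) = (x \in A) (+) (x \in B).
  apply/idP/idP => [/set_mem[[Ax nBx]|[Bx nAx]]|].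
  - by rewrite (mem_set Ax) (memNset nBx).
  - by rewrite (mem_set Bx) (memNset nAx).
  have [Ax|nAx] := pselect (A x); have [Bx|nBx] := pselect (B x).
  - by rewrite (mem_set Ax) (mem_set Bx).
  - by move=> _; apply: mem_set; left.
  - by move=> _; apply: mem_set; right.
  - by rewrite (memNset nAx) (memNset nBx).
by case: (x \in A); case: (x \in B) => /=; lra.
Qed.

(** The time t is approximated from below because the times rat01 i stay
    below 1. *)
Lemma step_limit_itv (t : R) : 0 < t -> t <= 1 -> step_limit \1_(`]0, t]%classic).
Proof.
move=> t0 t1 eta eta0.
have [|||i /andP[qi qt]] := @rat01_dense (Num.max 0 (t - eta)) t.
- by rewrite le_max lexx.
- by rewrite gt_max t0 ltrBlDr ltrDl.
- by [].
exists [:: (1, i)].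
have -> : step [:: (1, i)] = \1_(`]0, rat01 i]%classic).
  by apply/funext => x; rewrite /step big_seq1 mul1r.
rewrite sqdist_indic; [|exact: measurable_itv..].
have sub : symdiff `]0, t]%classic `]0, rat01 i]%classic `<=` `]rat01 i, t]%classic.
  move=> x [[]|[]] /=; rewrite !in_itv/= => /andP[x0 xt].
    by rewrite x0 xt andbT => /negP; rewrite ltNge.
  by rewrite x0 (le_trans xt (ltW qt)).
have mS : measurable (symdiff `]0, t]%classic `]0, rat01 i]%classic).
  by apply: measurable_symdiff; exact: measurable_itv.
rewrite -lee_fin fineK ?lebesgue01_fin//.
apply: (@le_trans _ _ (leb `]rat01 i, t]%classic)).
  rewrite /lebesgue01 /mrestr le_measure ?inE//; first by apply: measurableI.
  by move=> x [/sub].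
rewrite lebesgue_measure_itv/= lte_fin qt -EFinB lee_fin.
by move: qi; rewrite gt_max => /andP[_]; lra.
Qed.

(** The sets whose indicators are limits of step functions form a
    lambda-system that contains the half-lines ]x, +oo[. *)
Lemma step_limit_indic (A : set R) : measurable A -> step_limit \1_A.
Proof.
pose H : set (set R) := [set A | measurable A /\ step_limit \1_A].
suff : measurable `<=` H by move=> sub /sub[].
clear A.
have sqi (B : set R) : measurable B -> (\1_B : R -> R) \in sqint by exact: sqint_indic.
rewrite -[X in X `<=` _]/((@ocitv R).-sigma.-measurable) RGenOInfty.measurableE.
apply: lambda_system_subset => //.
- move=> _ _ [x ->] [y ->]; exists (Num.max x y).
  apply/seteqP; split => z /=; rewrite !in_itv/= !andbT gt_max.
    by move=> [-> ->].
  by move=> /andP[].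
- split => //.
  + split; first exact: measurableT.
    apply: step_limit_close; first exact: sqi.
    move=> eta eta0; exists \1_(`]0, 1]%classic); split.
    * by apply: sqi; exact: measurable_itv.
    * exact: step_limit_itv.
    * rewrite (sqdist_indic measurableT (measurable_itv _)).
      rewrite [X in fine X](_ : _ = 0%E) ?ltW//.
      rewrite /lebesgue01 /mrestr (_ : _ `&` _ = set0) ?measure0//.
      rewrite -subset0 => x [[[_ nx]|[_ /(_ I)//]]] /=.
      rewrite in_itv/= => /andP[x0 x1]; apply: nx.
      by rewrite /= in_itv/= x0 ltW.
  + move=> A B BA [mA LA] [mB LB]; split; first exact: measurableD.
    have -> : \1_(A `\` B) = (fun x => \1_A x + -1 * \1_B x) :> (R -> R).
      apply/funext => x; rewrite !indicE.
      have [Bx|nBx] := pselect (B x).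
        rewrite (mem_set Bx) (mem_set (BA _ Bx)) memNset; last by case.
        by rewrite /= mulN1r subrr.
      have [Ax|nAx] := pselect (A x).
        rewrite mem_set; last by split.
        by rewrite (mem_set Ax) (memNset nBx) /= mulr0 addr0.
      rewrite memNset; last by case.
      by rewrite (memNset nAx) (memNset nBx) /= mulr0 addr0.
    apply: step_limitD => //; [exact: sqi|apply: sqintZ; exact: sqi|].
    by apply: step_limitZ => //; exact: sqi.
  + move=> F ndF HF.
    have mF n : measurable (F n) by case: (HF n).
    have mU : measurable (\bigcup_n F n) by exact: bigcupT_measurable.
    split => //; apply: step_limit_close; first exact: sqi.
    move=> eta eta0.
    have cvg0 : (mu01 \o (fun n => \bigcup_k F k `\` F n)) @ \oo --> mu01 set0.
      have -> : set0 = \bigcap_n (\bigcup_k F k `\` F n).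
        apply/esym; rewrite -subset0 => x HH; have [[k _ Fk] _] := HH 0%N I.
        by have [_] := HH k I.
      apply: nonincreasing_cvg_mu.
      - have mD : measurable (\bigcup_k F k `\` F 0%N) by exact: measurableD.
        by rewrite ltey_eq lebesgue01_fin.
      - move=> n; exact: (measurableD mU (mF n)).
      - apply: bigcapT_measurable => n; exact: (measurableD mU (mF n)).
      - move=> a b ab; apply/subsetPset => x [Ux nF]; split => // Fx; apply: nF.
        by move: x Fx {Ux}; apply/subsetPset; exact: ndF.
    rewrite measure0 in cvg0; move/fine_cvg : cvg0 => /cvgrPdist_le/(_ _ eta0)[N _ HN].
    exists \1_(F N); split; [exact: sqi|by case: (HF N)|].
    rewrite sqdist_indic//.
    have -> : symdiff (\bigcup_k F k) (F N) = \bigcup_k F k `\` F N.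
      rewrite /symdiff (_ : F N `\` _ = set0) ?setU0// -subset0 => x [Fx] [].
      by exists N.
    have := HN N (leqnn N); rewrite /= sub0r normrN.
    exact: le_trans (ler_norm _).
- move=> _ [x ->]; split; first exact: measurable_itv.
  (* On (0, 1) the half-line ]x, +oo[ is ]t, 1]. *)
  pose t := Num.min (Num.max x 0) 1.
  have t0 : 0 <= t by rewrite le_min ler01 le_max lexx orbT.
  have t1 : t <= 1 by rewrite ge_min lexx orbT.
  have mt : measurable (`]t, 1]%classic : set R) by exact: measurable_itv.
  apply: step_limit_close; first by apply: sqi; exact: measurable_itv.
  move=> eta eta0; exists \1_(`]t, 1]%classic); split; first exact: sqi.
  + have -> : \1_(`]t, 1]%classic) =
        (fun x => \1_(`]0, 1]%classic) x + -1 * \1_(`]0, t]%classic) x) :> (R -> R).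
      by apply/funext => y; rewrite (indic_itv_split t0 t1); lra.
    apply: step_limitD.
    * by apply: sqi; exact: measurable_itv.
    * by apply: sqintZ; apply: sqi; exact: measurable_itv.
    * exact: step_limit_itv.
    * have st : (\1_(`]0, t]%classic) : R -> R) \in sqint.
        by apply: sqi; exact: measurable_itv.
      apply: step_limitZ => //.
      move: t0; rewrite le_eqVlt => /predU1P[t00|t0]; last exact: step_limit_itv.
      rewrite -t00 set_itv_ge ?bnd_simp ?ltxx// indic0 => e e0; exists [::].
      rewrite /sqdist (_ : (fun x => _) = (fun x => 0 * \1_(`]0, t]%classic) x)).
        by rewrite ipZl ?sqintZ// mul0r ltW.
      by apply/funext => y; rewrite /step big_nil/=; lra.
  + rewrite (sqdist_indic (measurable_itv _) (measurable_itv _)).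
    rewrite [X in fine X](_ : _ = 0%E) ?ltW//.
    rewrite /lebesgue01 /mrestr (_ : _ `&` _ = set0) ?measure0//.
    rewrite -subset0 => y [sy] /=; rewrite in_itv/= => /andP[y0 y1].
    have yt : (t < y) = (x < y).
      by rewrite /t gt_min gt_max y0 andbT (le_gtF (ltW y1)) orbF.
    by case: sy => -[] /=; rewrite !in_itv/= ?andbT yt (ltW y1) andbT => ->.
Qed.

Import HBNNSimple.

(** Simple functions increase to f, and the squared distances are dominated by
    f ^+ 2. *)
Lemma step_limit_nonneg f : f \in sqint -> (forall x, 0 <= f x) -> step_limit f.
Proof.
move=> hf f0; have mf := sqint_measurable hf.
have mEf : measurable_fun setT (EFin \o f : measurableTypeR R -> \bar R).
  exact/measurable_EFinP.
pose g_ := nnsfun_approx measurableT mEf.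
have g_le n x : g_ n x <= f x.
  by rewrite -lee_fin /g_ nnsfun_approxE; apply: le_approx => // y _; rewrite lee_fin.
have g_cvg x : g_ n x @[n --> \oo] --> f x.
  have f0' y : setT y -> (0 <= (EFin \o f) y)%E by rewrite lee_fin.
  exact: (fine_cvg (cvg_nnsfun_approx measurableT mEf f0' (I : setT x))).
have g_sq n : (g_ n : R -> R) \in sqint.
  apply: (sqint_le (g := f)) => // [|x].
    exact: (measurable_funPT (g_ n)).
  by rewrite !ger0_norm.
have g_step n : step_limit (g_ n).
  pose s : seq R := finmap.enum_fset (fset_set (g_ n @` setT)).
  rewrite (_ : (g_ n : R -> R) =
      (fun x => \sum_(i < size s) (s`_i * \1_(g_ n @^-1` [set s`_i]) x))); last first.
    by apply/funext => x; rewrite {1}(fimfunEord (g_ n)).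
  have mi i : measurable (g_ n @^-1` [set s`_i] : set R).
    exact: (measurable_funPTI (g_ n)).
  apply: (@step_limit_sum _ (fun i x => s`_i * \1_(g_ n @^-1` [set s`_i]) x)) => i.
    by apply: sqintZ; exact: sqint_indic.
  by apply: step_limitZ; [exact: sqint_indic|exact: step_limit_indic].
apply: step_limit_close => // eta eta0.
have sd_cvg : sqdist f (g_ n) @[n --> \oo] --> 0.
  apply: fine_cvg.
  have [|||||_ _] := @dominated_convergence _ _ R mu01 setT measurableT
    (fun n x => ((f x + -1 * g_ n x) * (f x + -1 * g_ n x))%:E) (cst 0%E)
    (fun x => (f x * f x)%:E).
  - move=> n; apply/measurable_EFinP; apply: measurable_funM.
      by apply: sqint_measurable; apply: sqintD => //; exact: sqintZ.
    by apply: sqint_measurable; apply: sqintD => //; exact: sqintZ.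
  - exact: measurable_cst.
  - apply: aeW => x _; apply: cvg_EFin; first by apply: nearW.
    rewrite [X in _ --> X](_ : _ = (f x + -1 * f x) * (f x + -1 * f x)); last first.
      by rewrite /=; ring.
    apply: cvgM; (apply: cvgD; first exact: cvg_cst); apply: cvgM => //; exact: cvg_cst.
  - exact: integrableM_sqint.
  - apply: aeW => x n _; rewrite abse_EFin lee_fin.
    rewrite ger0_norm -?expr2 ?sqr_ge0//.
    have := g_le n x; have : 0 <= g_ n x by [].
    move=> h1 h2; rewrite !expr2; nra.
  - by rewrite integral0.
move/cvgrPdist_le : sd_cvg => /(_ _ eta0)[N _ HN].
exists (g_ N); split => //.
by have := HN N (leqnn N); rewrite /= sub0r normrN; exact: le_trans (ler_norm _).
Qed.

Theorem step_dense f : f \in sqint -> step_limit f.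
Proof.
move=> hf; have mf := sqint_measurable hf.
have fE : f = (fun x => f^\+ x + -1 * f^\- x).
  by apply/funext => x; rewrite -{1}(funrposBneg f) mulN1r.
have hp : f^\+ \in sqint.
  apply: (sqint_le (g := f)) => //; first exact: measurable_funrpos.
  by move=> x; rewrite ger0_norm ?funrpos_ge0// /funrpos ge_max ler_norm normr_ge0.
have hn : f^\- \in sqint.
  apply: (sqint_le (g := f)) => //; first exact: measurable_funrneg.
  by move=> x; rewrite ger0_norm ?funrneg_ge0// /funrneg ge_max -normrN ler_norm normr_ge0.
rewrite fE; apply: step_limitD => //; first exact: sqintZ.
  by apply: step_limit_nonneg => // x; exact: funrpos_ge0.
by apply: step_limitZ => //; apply: step_limit_nonneg => // x; exact: funrneg_ge0.
Qed.

End step_density.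

(** * Signals seen through finitely many coordinates *)

Section separation.
Variable R : realType.
Notation mu01 := (@lebesgue01 R).
Notation sqint := (Lfun mu01 2%:E).

Definition coords (f : R -> R) (i : nat) : R := prim f (rat01 R i).

(** The number of coordinates and the precision share the parameter N; the
    relation gets stronger as N grows. *)
Definition close (N : nat) (u v : nat -> R) : Prop :=
  forall i, (i < N)%N -> `|u i - v i| < N.+1%:R^-1.

Lemma close_le N N' u v : (N <= N')%N -> close N' u v -> close N u v.
Proof.
move=> NN' H i iN; apply: lt_le_trans (H i (leq_trans iN NN')) _.
by rewrite lef_pV2 ?posrE// ler_nat.
Qed.

Lemma close_sym N u v : close N u v -> close N v u.
Proof. by move=> H i iN; rewrite distrC; exact: H. Qed.

(** At the index 2 * N + 1 the tolerance is half of the tolerance at N. *)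
Lemma close_trans N u v z : close N.*2.+1 u v -> close N.*2.+1 v z -> close N u z.
Proof.
move=> uv vz i iN.
have iN2 : (i < N.*2.+1)%N.
  by rewrite ltnS -addnn (leq_trans (ltnW iN))// leq_addr.
have -> : u i - z i = (u i - v i) + (v i - z i) by ring.
apply: le_lt_trans (ler_normD _ _) _.
have h : N.*2.+2%:R^-1 = N.+1%:R^-1 / 2 :> R.
  by rewrite -doubleS -muln2 natrM invfM.
have := uv i iN2; have := vz i iN2; rewrite h => h1 h2.
by apply: lt_le_trans (ltrD h2 h1) _; rewrite -splitr.
Qed.

(** Replace g by a step function: its inner products are combinations of
    coordinates, and the error is small uniformly on the ball. *)
Lemma coords_control M f g e : f \in sqint -> g \in sqint -> 0 < e ->
  exists N, forall f', f' \in sqint -> ip f' f' <= M ->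
    close N (coords f') (coords f) -> `|ip f' g - ip f g| < e.
Proof.
move=> hf hg e0.
pose M2 := 2 * `|M| + 2 * ip f f + 1.
have M20 : 0 < M2.
  by rewrite /M2; have := ip_ge0 f; have := normr_ge0 M; lra.
(* k and the quality k * e / 2 of the approximation of g balance the two terms
   of ip_amgm at e / 2 each. *)
pose k := e / (2 * M2).
have k0 : 0 < k by rewrite divr_gt0// mulr_gt0.
have eta0 : 0 < k * e / 2 by rewrite divr_gt0// mulr_gt0.
have [l gl] := step_dense hg eta0.
pose sa := \sum_(p <- l) `|p.1|.
have sa0 : 0 <= sa by apply: sumr_ge0.
have sae0 : 0 <= 2 * sa / e by rewrite divr_ge0 ?mulr_ge0// ltW.
(* N exceeds the indices of all the jumps, and N + 1 exceeds 2 * sa / e. *)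
pose N := maxn (\max_(p <- l) p.2.+1) (Num.truncn (2 * sa / e)).+1.
exists N => f' hf' f'M cl.
have hu : (fun x => f' x + -1 * f x) \in sqint by apply: sqintD => //; exact: sqintZ.
have hst := sqint_step l.
have hd : (fun x => g x + -1 * step l x) \in sqint by apply: sqintD => //; exact: sqintZ.
have -> : ip f' g - ip f g = ip (fun x => f' x + -1 * f x) g.
  by rewrite ipDl ?sqintZ// ipZl//; ring.
have -> : ip (fun x => f' x + -1 * f x) g =
    ip (fun x => f' x + -1 * f x) (fun x => g x + -1 * step l x) +
    ip (fun x => f' x + -1 * f x) (step l).
  by rewrite ipDr ?sqintZ// ipZr//; ring.
have uM2 : ip (fun x => f' x + -1 * f x) (fun x => f' x + -1 * f x) <= M2.
  apply: le_trans (ip_sqD_le hf' (sqintZ (-1) hf)) _.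
  rewrite ipZl ?sqintZ// ipZr// /M2; have := ler_norm M; lra.
have h1 : `|ip (fun x => f' x + -1 * f x) (fun x => g x + -1 * step l x)| <= e / 2.
  have := ip_amgm k0 hu hd.
  have c1 : k * ip (fun x => f' x + -1 * f x) (fun x => f' x + -1 * f x) <= e / 2.
    have -> : e / 2 = k * M2 by rewrite /k; field; rewrite gt_eqF.
    by rewrite ler_pM2l.
  have c2 : k^-1 * ip (fun x => g x + -1 * step l x) (fun x => g x + -1 * step l x)
      <= e / 2.
    have -> : e / 2 = k^-1 * (k * e / 2) by field; rewrite gt_eqF.
    by rewrite ler_pM2l ?invr_gt0.
  lra.
have h2 : `|ip (fun x => f' x + -1 * f x) (step l)| < e / 2.
  rewrite ipC ip_suml//; last first.
    by move=> p; apply: sqintZ; apply: sqint_indic; exact: measurable_itv.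
  apply: le_lt_trans (ler_norm_sum _ _ _) _.
  apply: (@le_lt_trans _ _ (\sum_(p <- l) `|p.1| * N.+1%:R^-1)).
    rewrite big_seq [leRHS]big_seq; apply: ler_sum => p pl.
    have si : (\1_(`]0, rat01 R p.2]%classic) : R -> R) \in sqint.
      by apply: sqint_indic; exact: measurable_itv.
    rewrite ipZl// normrM ler_wpM2l// ipC ipDl ?sqintZ// ipZl// -!primE mulN1r.
    apply/ltW/cl; rewrite /N leq_max; apply/orP; left.
    by rewrite (big_rem p)//= leq_maxl.
  rewrite -mulr_suml -/sa ltr_pdivrMr//.
  have /andP[_] := truncn_itv sae0; rewrite ltr_pdivrMr// => h.
  have : (Num.truncn (2 * sa / e)).+1%:R <= N.+1%:R :> R.
    by rewrite ler_nat (leq_trans _ (leqnSn _))// leq_maxr.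
  move=> h'; have := lt_le_trans h (ler_wpM2r (ltW e0) h'); lra.
by apply: le_lt_trans (ler_normD _ _) _; lra.
Qed.

(** A box around S that avoids A is defined by finitely many inner products, and
    each of them is controlled by finitely many coordinates. *)
Lemma closed_ball_separated (A : set (weakL2 R)) M (S : L2 R) :
  closed A -> A `<=` L2_ball M -> ~ A S ->
  exists N, forall S', A S' -> ~ close N (coords (L2_fun S')) (coords (L2_fun S)).
Proof.
move=> /weak_closedP cA AM nAS; have [gs [e e0 H]] := cA _ nAS.
suff [N HN] : exists N, forall S', A S' ->
    close N (coords (L2_fun S')) (coords (L2_fun S)) -> weak_box S gs e S'.
  by exists N => S' AS' /(HN _ AS')/H.
elim: gs {H} => [|g gs [N1 H1]]; first by exists 0%N => S' _ _ g.
have [N2 H2] := coords_control M (L2_fun_Lfun S) (L2_fun_Lfun g) e0.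
exists (maxn N1 N2) => S' AS' cl g'; rewrite inE => /predU1P[->|]; last first.
  by apply: H1 => //; apply: close_le cl; exact: leq_maxl.
apply: H2; [exact: L2_fun_Lfun|exact: AM|].
by apply: close_le cl; exact: leq_maxr.
Qed.

Definition path_coords (y : path01 R) (i : nat) : R := pathval (rat01 R i) y.

(** The regions of acceptance and of rejection of the tests are built from these
    sets, which contain the observations without noise of the elements
    of A. *)
Definition nearby (N : nat) (A : set (L2 R)) : set (path01 R) :=
  [set y | exists2 S, A S & close N (path_coords y) (coords (L2_fun S))].

Lemma nearby_subset N A B : A `<=` B -> nearby N A `<=` nearby N B.
Proof. by move=> AB y [S /AB BS cl]; exists S. Qed.

(** An uncountable union of boxes in finitely many coordinates is open, hence the
    countable union of the boxes with rational ends that it contains. *)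
Lemma measurable_nearby N A : measurable (nearby N A).
Proof.
pose r := N.+1%:R^-1 : R.
(* The lists of the lower and of the upper bounds, one entry per coordinate. *)
pose box (p : seq rat * seq rat) : set (path01 R) :=
  [set y | forall i, (i < N)%N -> ratr p.1`_i < path_coords y i < ratr p.2`_i].
pose good (p : seq rat * seq rat) : Prop := exists2 S, A S &
  forall i, (i < N)%N -> coords (L2_fun S) i - r <= ratr p.1`_i /\
                         ratr p.2`_i <= coords (L2_fun S) i + r.
have mbox p : measurable (box p).
  have -> : box p = \bigcap_(i in `I_N)
      (path_coords^~ i @^-1` `]ratr p.1`_i, ratr p.2`_i[).
    by apply/seteqP; split => y /= H i iN; have := H i iN; rewrite /= in_itv.
  apply: bigcap_measurableType => i _; rewrite -[X in measurable X]setTI.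
  exact: (measurable_pathval (rat01 R i) measurableT (measurable_itv _)).
have -> : nearby N A = \bigcup_n (if unpickle n is Some p then
    (if `[< good p >] then box p else set0) else set0).
  apply/seteqP; split => [y [S AS cl]|y [n _]]; last first.
    case: unpickle => // p; case: asboolP => // -[S AS gS] by_.
    exists S => // i iN; have [g1 g2] := gS i iN.
    by have /andP[b1 b2] := by_ i iN; rewrite ltr_distlC; apply/andP; split; rewrite -/r; lra.
  have H i : (i < N)%N -> exists q : rat * rat,
      [/\ coords (L2_fun S) i - r <= ratr q.1, ratr q.1 < path_coords y i,
          path_coords y i < ratr q.2 & ratr q.2 <= coords (L2_fun S) i + r].
    move=> iN; have := cl i iN; rewrite distrC ltr_distlC => /andP[h1 h2].
    have [a] := rat_in_itvoo h1; rewrite in_itv/= => /andP[a1 a2].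
    have [b] := rat_in_itvoo h2; rewrite in_itv/= => /andP[b1 b2].
    by exists (a, b); split => //=; rewrite ltW.
  have {H}/choice[q Hq] i : exists q : rat * rat, (i < N)%N ->
      [/\ coords (L2_fun S) i - r <= ratr q.1, ratr q.1 < path_coords y i,
          path_coords y i < ratr q.2 & ratr q.2 <= coords (L2_fun S) i + r].
    have [iN|Ni] := ltnP i N; last by exists (0, 0).
    by have [q Hq] := H i iN; exists q.
  pose p := (mkseq (fun i => (q i).1) N, mkseq (fun i => (q i).2) N).
  exists (pickle p) => //; rewrite pickleK; case: asboolP => [_|[]].
    by move=> i iN; rewrite /p /= !nth_mkseq//; have [_ -> -> _] := Hq i iN.
  by exists S => // i iN; rewrite /p /= !nth_mkseq//; have [] := Hq i iN.
apply: bigcupT_measurable => n; case: unpickle => // p.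
by case: ifP.
Qed.

End separation.

(** * From sets to tests *)

Section noise_control.
Context d (Omega : measurableType d) (R : realType) (P : probability Omega R).
Variables (w : R -> Omega -> R) (hw : wiener_process P w).

(** The tests may err outside this event only; it involves the noise alone, so
    that one event serves all signals. *)
Definition tame (k : nat) : set Omega :=
  [set omega | forall i, `|w (rat01 R i) omega| <= k%:R].

Lemma measurable_tame k : measurable (tame k).
Proof.
have -> : tame k = \bigcap_i (w (rat01 R i) @^-1` `[- k%:R, k%:R]).
  apply/seteqP; split => omega /= H i; first by move=> _ /=; rewrite in_itv/= -ler_norml.
  by have := H i I; rewrite /= in_itv/= -ler_norml.
apply: bigcapT_measurable => i; rewrite -[X in measurable X]setTI.
have mw : measurable_fun setT (w (rat01 R i)).
  apply: (wiener_measurable hw).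
  by have /andP[/ltW -> /ltW ->] := rat01_itv R i.
exact: (mw measurableT _ (measurable_itv _)).
Qed.

(** Almost every path of w is continuous on [0, 1], hence bounded. *)
Lemma tame_cvg : fine (P (~` tame k)) @[k --> \oo] --> (0 : R).
Proof.
have mt k : measurable (~` tame k) by apply: measurableC; exact: measurable_tame.
apply: fine_cvg.
have <- : P (\bigcap_k ~` tame k) = 0%:E.
  apply/negligibleP; first exact: bigcapT_measurable.
  apply: negligibleS (wiener_continuous hw) => omega H /= cw.
  have [c _ cmax] := EVT_max ler01 cw; have [c' _ cmin] := EVT_min ler01 cw.
  pose m := `|w c omega| + `|w c' omega|.
  have m0 : 0 <= m by rewrite addr_ge0.
  apply: (H (Num.truncn m).+1 I) => i.
  have /andP[_ /ltW mk] := truncn_itv m0; apply: le_trans mk.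
  have ti : rat01 R i \in `[0, 1]%R.
    by rewrite in_itv/=; have /andP[/ltW -> /ltW ->] := rat01_itv R i.
  have h1 := cmax _ ti; have h2 := cmin _ ti.
  rewrite ler_norml /m; apply/andP; split.
    have := normr_ge0 (w c omega); have := ler_norm (- w c' omega).
    by rewrite normrN; lra.
  by have := normr_ge0 (w c' omega); have := ler_norm (w c omega); lra.
apply: nonincreasing_cvg_mu => //.
- by rewrite ltey_eq fin_num_measure.
- exact: bigcapT_measurable.
- move=> a b ab; apply/subsetPset => omega nb ta; apply: nb => i.
  by apply: le_trans (ta i) _; rewrite ler_nat.
Qed.

(** Any integer that tends to infinity more slowly than 1 / eps would do: the
    number of coordinates grows while the noise stays below the precision. *)
Definition resolution (eps : R) : nat := Num.truncn (Num.sqrt eps^-1).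

Lemma near_sqrt_inv (M : R) : \forall eps \near (0 : R)^'+, M < Num.sqrt eps^-1.
Proof.
have M1 : 0 < `|M| + 1 by rewrite ltr_wpDl.
near=> eps.
have eps0 : 0 < eps by near: eps; exact: nbhs_right_gt.
have epsM : eps < (`|M| + 1) ^- 2.
  by near: eps; apply: nbhs_right_lt; rewrite invr_gt0 exprn_gt0.
apply: (@le_lt_trans _ _ `|M|); first exact: ler_norm.
rewrite -[ltLHS]sqrtr_sqr ltr_sqrt ?invr_gt0//.
apply: (@lt_le_trans _ _ ((`|M| + 1) ^+ 2)).
  by rewrite -[M ^+ 2]real_normK ?num_real// ltr_sqr ?nnegrE ?addr_ge0// ltrDl.
by rewrite -[leLHS]invrK lef_pV2 ?posrE ?invr_gt0 ?exprn_gt0// ltW.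
Unshelve. all: by end_near. Qed.

Lemma resolution_large (N : nat) : \forall eps \near (0 : R)^'+, (N <= resolution eps)%N.
Proof.
apply: filterS (near_sqrt_inv N%:R) => eps h; rewrite /resolution.
by rewrite truncn_ge_nat ?sqrtr_ge0// ltW.
Qed.

Lemma path_coordsE eps f omega i :
  path_coords (signal_path w eps f omega) i = coords f i + eps * w (rat01 R i) omega.
Proof.
have /andP[q0 q1] := rat01_itv R i.
by rewrite /path_coords pathval_signal_path ?ltW// /wiener0 gt_eqF.
Qed.

Lemma tame_close k : \forall eps \near (0 : R)^'+, forall f omega, tame k omega ->
  close (resolution eps) (path_coords (signal_path w eps f omega)) (coords f).
Proof.
near=> eps => f omega tk i _.
have eps0 : 0 < eps by near: eps; exact: nbhs_right_gt.
have s1 : 1 < Num.sqrt eps^-1 by near: eps; exact: near_sqrt_inv.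
have s2 : 2 * k%:R < Num.sqrt eps^-1 by near: eps; exact: near_sqrt_inv.
rewrite path_coordsE addrAC subrr add0r normrM (ger0_norm (ltW eps0)).
set s := Num.sqrt eps^-1 in s1 s2 *.
have sE : s ^+ 2 = eps^-1 by rewrite sqr_sqrtr// invr_ge0 ltW.
have N1 : (resolution eps).+1%:R <= 2 * s.
  have /andP[h _] := truncn_itv (sqrtr_ge0 eps^-1).
  by rewrite -natr1 /resolution; rewrite -/s in h *; lra.
rewrite -[ltRHS]mul1r ltr_pdivlMr// -(ltr_pM2l (_ : 0 < eps^-1)) ?invr_gt0//.
rewrite mulr1 -mulrA mulKf ?gt_eqF// -sE.
apply: (@le_lt_trans _ _ (k%:R * (2 * s))).
  by apply: ler_pM => //; exact: tk.
by rewrite expr2 mulrA (mulrC k%:R) ltr_pM2r// (lt_trans ltr01).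
Unshelve. all: by end_near. Qed.

Lemma nearby_observation k A S : A S -> \forall eps \near (0 : R)^'+,
  forall omega, tame k omega ->
  nearby (resolution eps) A (observation w eps S omega).
Proof.
by move=> AS; apply: filterS (tame_close k) => eps H omega tk; exists S => //; exact: H.
Qed.

(** A signal of A close to the path would be close to S, which is close to the
    path. *)
Lemma not_nearby_observation k (A : set (weakL2 R)) M S :
  closed A -> A `<=` L2_ball M -> ~ A S -> \forall eps \near (0 : R)^'+,
  forall omega, tame k omega ->
  ~ nearby (resolution eps) A (observation w eps S omega).
Proof.
move=> cA AM nAS; have [N HN] := closed_ball_separated cA AM nAS.
near=> eps => omega tk [S' AS' cl'].
have Nr : (N.*2.+1 <= resolution eps)%N by near: eps; exact: resolution_large.
have cl : close (resolution eps) (path_coords (signal_path w eps (L2_fun S) omega))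
    (coords (L2_fun S)).
  by move: omega tk {cl'}; near: eps; apply: filterS (tame_close k) => eps H omega; exact: H.
apply: (HN S' AS'); apply: (close_trans (v := path_coords (observation w eps S omega))).
  by apply/close_sym; exact: close_le cl'.
exact: close_le cl.
Unshelve. all: by end_near. Qed.

Lemma mean_indic eps (C : set (path01 R)) f : measurable C ->
  mean P w eps (\1_C) f = law P w eps f C.
Proof.
move=> mC; rewrite /mean /law; congr fine.
have mf := measurable_preimage_path hw eps f mC.
rewrite -(expectation_indic P mf); congr expectation.
Qed.

Lemma is_test_indic (C : set (path01 R)) : measurable C -> is_test (\1_C : path01 R -> R).
Proof.
move=> mC; split; first exact: measurable_indic.
by move=> y; rewrite indicE; case: (_ \in _); rewrite ?ler01 ?lexx.
Qed.

Lemma law_le_tame eps k f C : measurable C ->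
  (forall omega, tame k omega -> ~ C (signal_path w eps f omega)) ->
  law P w eps f C <= fine (P (~` tame k)).
Proof.
move=> mC H; have mf := measurable_preimage_path hw eps f mC.
have mt : measurable (~` tame k) by apply: measurableC; exact: measurable_tame.
rewrite -lee_fin lawE// fineK ?fin_num_measure// le_measure ?inE//.
by move=> omega Cw tk; exact: (H omega tk).
Qed.

(** The event is chosen first, with k large, and only then eps. *)
Lemma error_cvg0 (e : R -> R) : (forall eps, 0 < eps -> 0 <= e eps) ->
  (forall k, \forall eps \near (0 : R)^'+, e eps <= fine (P (~` tame k))) ->
  e eps @[eps --> 0^'+] --> (0 : R).
Proof.
move=> e0 H; apply/cvgrPdist_le => eta eta0.
move/cvgrPdist_le : tame_cvg => /(_ _ eta0)[k _ /(_ k (leqnn k))].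
rewrite /= sub0r normrN => hk.
near=> eps.
have eps0 : 0 < eps by near: eps; exact: nbhs_right_gt.
rewrite sub0r normrN ger0_norm ?e0//.
apply: le_trans (le_trans (ler_norm _) hk).
by near: eps; exact: H.
Unshelve. all: by end_near. Qed.

End noise_control.

Section sets_to_tests.
Context d (Omega : measurableType d) (R : realType) (P : probability Omega R).
Variables (w : R -> Omega -> R) (hw : wiener_process P w).

Lemma err1_indic (T : R -> set (path01 R)) S eps : measurable (T eps) ->
  err1 P w (fun eps => \1_(T eps)) S eps = law P w eps (L2_fun S) (T eps).
Proof. by move=> mT; rewrite err1_mean mean_indic. Qed.

Lemma err2_indic (T : R -> set (path01 R)) S eps : measurable (T eps) ->
  err2 P w (fun eps => \1_(T eps)) S eps = law P w eps (L2_fun S) (~` T eps).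
Proof.
move=> mT; rewrite err2_mean -mean_indic//; last exact: measurableC.
congr mean; apply/funext => y; rewrite !indicE in_setC.
by case: (y \in _); rewrite /= ?subrr ?subr0.
Qed.

Lemma law_ge0 eps f C : 0 <= law P w eps f C.
Proof. exact: fine_ge0. Qed.

Lemma separated_consistent (Theta0 Theta1 : set (L2 R)) (A : set (weakL2 R)) :
  L2_bounded Theta0 -> closed A -> Theta0 `<=` A -> Theta1 `<=` ~` A ->
  exists K, consistent P w Theta0 Theta1 K.
Proof.
move=> /L2_bounded_ball[M T0M] cA T0A T1A.
pose A' : set (weakL2 R) := A `&` L2_ball M.
have cA' : closed A' by apply: closedI => //; exact: L2_ball_closed.
have A'M : A' `<=` L2_ball M by move=> S [].
pose T (eps : R) := ~` nearby (resolution eps) A'.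
have mT eps : measurable (T eps) by apply: measurableC; exact: measurable_nearby.
have T0_empty (E : forall S, ~ Theta0 S) (f : L2 R -> R) :
    [set f S | S in Theta0] = set0 by rewrite -subset0 => x [S /E].
exists (fun eps => \1_(T eps)); split.
- by move=> eps _; exact: is_test_indic.
- apply: (error_cvg0 hw).
    move=> eps eps0; have [[S T0S]|/forallNP E] := pselect (exists S, Theta0 S).
      apply: (@le_trans _ _ (err1 P w (fun eps => \1_(T eps)) S eps)).
        by rewrite err1_indic// law_ge0.
      apply: ub_le_sup; last by exists S.
      exists 1 => _ [S' _ <-]; rewrite err1_mean.
      by have /andP[] := mean01 hw eps (L2_fun S') (is_test_indic (mT eps)).
    by rewrite (T0_empty E) sup0.
  move=> k; apply: filterS (tame_close w k) => eps H.
  have [[S T0S]|/forallNP E] := pselect (exists S, Theta0 S); last first.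
    by rewrite (T0_empty E) sup0 fine_ge0.
  apply: ge_sup; first by exists (err1 P w (fun eps => \1_(T eps)) S eps), S.
  move=> _ [S' T0S' <-]; rewrite err1_indic//.
  apply: (law_le_tame hw) => // omega tk; apply; exists S'.
    by split; [exact: T0A|exact: T0M].
  exact: H.
- move=> S T1S; apply: (error_cvg0 hw).
    by move=> eps _; rewrite err2_indic// law_ge0.
  have nA' : ~ A' S by move=> [AS _]; exact: (T1A S T1S).
  move=> k; apply: filterS (not_nearby_observation w k cA' A'M nA') => eps H.
  rewrite err2_indic//; apply: (law_le_tame hw); first exact: measurableC.
  by move=> omega tk; rewrite /T setCK; exact: H.
Qed.

(** Balls make the closed sets bounded, and finite unions make them
    increasing. *)
Lemma Fsigma_exhaustion (A : set (weakL2 R)) : Fsigma A ->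
  exists a : nat -> set (weakL2 R),
    [/\ forall n, closed (a n), forall n, a n `<=` L2_ball n%:R,
        forall n m, (n <= m)%N -> a n `<=` a m & A = \bigcup_n a n].
Proof.
move=> [F cF ->].
exists (fun n => \big[setU/set0]_(i < n.+1) F i `&` L2_ball n%:R); split.
- move=> n; apply: closedI; last exact: L2_ball_closed.
  by apply: closed_bigsetU => i _.
- by move=> n S [].
- move=> n m nm S [FS bS]; split.
    by move: S FS {bS}; apply: subset_bigsetU.
  by apply: le_trans bS _; rewrite ler_nat.
- apply/seteqP; split => [S [n _ FnS]|S [n _ [FS _]]]; last first.
    by have [i _ FiS] := @bigsetU_bigcup _ F n.+1 S FS; exists i.
  pose m := maxn n (Num.truncn (L2_inner S S)).+1.
  exists m => //; split; first by apply: bigsetU_sup FnS; rewrite ltnS leq_maxl.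
  have /andP[_ /ltW h] := truncn_itv (ip_ge0 (L2_fun S)).
  by apply: le_trans h _; rewrite ler_nat leq_maxr.
Qed.

Lemma separated_pointwise_consistent (Theta0 Theta1 : set (L2 R))
    (A B : set (weakL2 R)) : Fsigma A -> Fsigma B ->
  Theta0 `<=` A -> Theta1 `<=` B -> A `&` B = set0 ->
  exists K, pointwise_consistent P w Theta0 Theta1 K.
Proof.
move=> /Fsigma_exhaustion[a [ca aM nda ->]] /Fsigma_exhaustion[b [cb bM ndb ->]].
move=> T0A T1B AB0.
have disj n m S : a n S -> b m S -> False.
  move=> an bm; have : set0 S by rewrite -AB0; split; [exists n|exists m].
  by [].
pose T (eps : R) := \bigcup_n (nearby (resolution eps) (b n) `&`
  \bigcap_(k in [set k | (k <= n)%N]) ~` nearby (resolution eps) (a k)).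
have mT eps : measurable (T eps).
  apply: bigcupT_measurable => n; apply: measurableI; first exact: measurable_nearby.
  by apply: bigcap_measurableType => k _; apply: measurableC; exact: measurable_nearby.
exists (fun eps => \1_(T eps)); split.
- by move=> eps _; exact: is_test_indic.
- move=> S /T0A[n _ anS]; apply: (error_cvg0 hw).
    by move=> eps _; rewrite err1_indic// law_ge0.
  have nbS : ~ b n S by move=> /(disj _ _ _ anS).
  move=> k; apply: filterS2 (nearby_observation w k anS)
    (not_nearby_observation w k (cb n) (bM n) nbS) => eps Ha Hb.
  rewrite err1_indic//; apply: (law_le_tame hw) => // omega tk [m _ [bm am]].
  (* The path is close to a n, hence rejection comes from some b m with m < n,
     and b m is contained in b n, from which the path is far. *)
  have [nm|mn] := leqP n m; first exact: (am n nm (Ha omega tk)).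
  by apply: (Hb omega tk); apply: nearby_subset bm; apply: ndb; exact: ltnW.
- move=> S /T1B[n _ bnS]; apply: (error_cvg0 hw).
    by move=> eps _; rewrite err2_indic// law_ge0.
  have naS : ~ a n S by move=> anS; exact: (disj _ _ _ anS bnS).
  move=> k; apply: filterS2 (nearby_observation w k bnS)
    (not_nearby_observation w k (ca n) (aM n) naS) => eps Hb Ha.
  rewrite err2_indic//; apply: (law_le_tame hw); first exact: measurableC.
  move=> omega tk; apply; exists n => //; split; first exact: Hb.
  by move=> m mn /(nearby_subset (nda m n mn)); exact: Ha.
Qed.

End sets_to_tests.

Theorem theorem5p4 (R : realType) (d : measure_display)
    (Omega : measurableType d) (P : probability Omega R)
    (w : R -> Omega -> R) (hw : wiener_process P w)
    (Theta0 Theta1 : set (L2 R)) :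
  (L2_bounded Theta0 ->
    ((exists K : R -> path01 R -> R, consistent P w Theta0 Theta1 K) <->
     (exists A B : set (weakL2 R),
        [/\ closed A, Fsigma B, Theta0 `<=` A, Theta1 `<=` B &
            A `&` B = set0])))
  /\
  ((exists K : R -> path01 R -> R, pointwise_consistent P w Theta0 Theta1 K) <->
   (exists A B : set (weakL2 R),
      [/\ Fsigma A, Fsigma B, Theta0 `<=` A, Theta1 `<=` B &
          A `&` B = set0])).
Proof.
split=> [bT0|]; split.
- by move=> [K]; exact: consistent_separated.
- move=> [A [B [cA _ T0A T1B AB0]]].
  apply: (separated_consistent hw bT0 cA T0A) => S /T1B BS AS.
  by have : set0 S by rewrite -AB0.
- by move=> [K]; exact: pointwise_consistent_separated.
- move=> [A [B [FA FB T0A T1B AB0]]].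
  exact: (separated_pointwise_consistent hw FA FB T0A T1B AB0).
Qed.
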